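(* Suppose $\xi_1,\ldots,\xi_n$ are $n$ independent random variables such that $\xi_i\sim GG(\alpha_i,\beta_i,\gamma_i)$, $i=1,\ldots,n$ (with $\alpha_i,\beta_i,\gamma_i>0$), and let $Z_n=\xi_1\cdots\xi_n$. Then $Z_n$ is M-det if and only if $\sum_{i=1}^n\frac{1}{\beta_i}\le 2$.
   Context: For $\alpha,\beta,\gamma>0$, $\xi\sim GG(\alpha,\beta,\gamma)$ (generalized gamma distribution) means that $\xi$ is a nonnegative random variable with density $f(x)=c\,x^{\gamma-1}e^{-\alpha x^{\beta}}$, $x\ge 0$, where $f(0)=0$ if $\gamma\ne 1$ and $c=\beta\alpha^{\gamma/\beta}/\Gamma(\gamma/\beta)$ is the norming constant. A random variable $X$ with distribution function $F$ and moments $m_k=\mathbf{E}[X^k]$ (all finite) is called moment determinate (M-det) if $F$ is the only distribution having the moment sequence $\{m_k\}_{k=1}^\infty$. *)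

(* Defs.v *)
From HB Require Import structures.
From mathcomp Require Export all_boot all_order all_algebra.
From mathcomp Require Export all_classical all_reals all_analysis.
Export Order.TTheory GRing.Theory Num.Theory.
Export numFieldNormedType.Exports.

Set Implicit Arguments.
Unset Strict Implicit.
Unset Printing Implicit Defensive.

Local Open Scope classical_set_scope.
Local Open Scope ring_scope.

Definition gamma_fun (R : realType) (s : R) : R :=
  \int[@lebesgue_measure R]_(x in `]0, +oo[) (x `^ (s - 1) * expR (- x)).

(* Since 0 `^ (g - 1) = (g - 1 == 0)%:R, the value at 0 is 0 when g != 1 and
   the normalizing constant when g = 1. *)
Definition gengamma_pdf (R : realType) (a b g : R) : R -> R :=
  (fun x => (b * a `^ (g / b) / gamma_fun (g / b)) *
            (x `^ (g - 1) * expR (- (a * x `^ b)))) \_ `[0, +oo[.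

(* The density vanishes on the negative half-line, so X >= 0 almost surely. *)
Definition gengamma_distributed d (T : measurableType d) (R : realType)
    (P : probability T R) (X : {RV P >-> R}) (a b g : R) : Prop :=
  forall A : set R, measurable A ->
    distribution P X A =
    (\int[@lebesgue_measure R]_(x in A) (gengamma_pdf a b g x)%:E)%E.
Arguments gengamma_distributed {d T R} P X a b g.

Definition mutually_independent d (T : measurableType d) (R : realType)
    (P : probability T R) (I : finType) (X : I -> {RV P >-> R}) : Prop :=
  forall (J : {set I}) (A : I -> set R), (forall i, measurable (A i)) ->
    P [set w | forall i, i \in J -> A i (X i w)] =
    (\prod_(i in J) P (X i @^-1` A i))%E.
Arguments mutually_independent {d T R} P {I} X.

Definition finite_moments d (T : measurableType d) (R : realType)
    (P : probability T R) (X : {RV P >-> R}) : Prop :=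
  forall k : nat, (0 < k)%N ->
    P.-integrable setT (fun w => (X w ^+ k)%:E).
Arguments finite_moments {d T R} P X.

(* The competing laws range over all Borel probability measures on the line,
   not only over those supported by the nonnegative half-line. *)
Definition moment_determinate d (T : measurableType d) (R : realType)
    (P : probability T R) (X : {RV P >-> R}) : Prop :=
  finite_moments P X /\
  forall Q : probability R R,
    (forall k : nat, (0 < k)%N ->
       (Q.-integrable setT (fun x : R => (x ^+ k)%:E) /\
        'E_Q[fun x : R => (x ^+ k)%R] = 'E_P[fun w => (X w ^+ k)%R])%E) ->
    forall A : set R, measurable A -> Q A = distribution P X A.
Arguments moment_determinate {d T R} P X.

(* Main.v *)
From HB Require Import structures.
Require Import Defs.
From mathcomp Require Import ring lra measurable_realfun.

Set Implicit Arguments.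
Unset Strict Implicit.
Unset Printing Implicit Defensive.

Local Open Scope classical_set_scope.
Local Open Scope ring_scope.

(** Let [B] be the sum of the inverse exponents [1 / beta i]. A generalized gamma
law of exponent [beta] has moments of order [k ^ (k / beta)] and a tail
comparable to [exp (- a * x ^ beta)]. Under independent products the moments
multiply, so [Z] has moments at most [L ^ k * k ^ (k * B)]
([partial_prod_moment_growth]); the inverse tail exponents add up, because
[z = x * (z / x)] with [x] of order [z ^ p] makes both factors equally unlikely
for a suitable [p], so the law of [Z] dominates a density
[C * x ^ m * exp (- c * x ^ (1 / B))] on the positive half-line
([partial_prod_heavy_tailed]). What remains is to see that [2] is critical.

If [B <= 2], the [k]-th moment of [Z] is at most [D ^ k * (2 k)!], and such a law
[mu] on the half-line is determined even among the laws [Q] on the whole line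
([half_line_determinate]). The function [cosq t x = cos (t * sqrt x)] is entire
in [x] and equals [cosh (t * sqrt (- x))] for [x <= 0]. For small [t] its power
series is dominated by [cosh (t * sqrt `|x|)], which the moment bound makes
integrable, so [Q] and [mu] give it the same integral; the addition formula
extends this to every [t] ([agree_cosqT]). The integral under [mu] is at most
[1], whereas mass of [Q] on the negative half-line would make it grow
exponentially with [t]: hence [Q] is carried by the half-line too
([ae_ge0_of_agree]). There, products of cosines are sums of cosines, powers
[cos (y / sqrt n) ^ n] tend to Gaussians, that is to all [exp (- a * x)], and
powers [(1 - exp (- n * x)) ^ K] tend to indicators of rays, so [Q = mu]
([eq_of_cosq]).

If [B > 2], then [d = 1 / B < 1 / 2], and the function
[exp (- l * cos (pi * d) * x ^ d) * sin (l * sin (pi * d) * x ^ d)] has vanishing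
moments of all orders, as one sees by rotating the contour of Gamma integrals
([stieltjes_fun_moment]). Choosing [l] such that [l * cos (pi * d) = c], the
multiple by [C * x ^ m] is bounded by the density which the law of [Z]
dominates. Adding it to the law of [Z] yields another probability with the same
moments ([heavy_tailed_not_determinate]). *)

(** * The entire function cos (t * sqrt x) *)

Section square_root_cosine.
Context {R : realType}.
Implicit Types x y t h : R.

Definition coshR (y : R) : R := (expR y + expR (- y)) / 2.

Lemma coshR_ge1 y : 1 <= coshR y.
Proof.
rewrite /coshR ler_pdivlMr// mul1r.
have : expR y * expR (- y) = 1 by rewrite expRxMexpNx_1.
have := expR_gt0 y; have := expR_gt0 (- y).
move: (expR y) (expR (-y)) => a b b0 a0 ab.
have := sqr_ge0 (a - b) => h2.
have : 2 ^+ 2 <= (a + b) ^+ 2 by nra.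
by rewrite ler_pXn2r// nnegrE; lra.
Qed.

Lemma coshR0 : coshR 0 = 1.
Proof. by rewrite /coshR oppr0 expR0; lra. Qed.

Lemma coshRN y : coshR (- y) = coshR y.
Proof. by rewrite /coshR opprK addrC. Qed.

Lemma coshRDB x y : coshR (x + y) + coshR (x - y) = 2 * coshR x * coshR y.
Proof.
rewrite /coshR !opprD !opprK !expRD.
by field.
Qed.

Lemma continuous_coshR : continuous coshR.
Proof.
move=> y; apply: cvgM; last exact: cvg_cst.
apply: cvgD; first exact: continuous_expR.
by apply: (@continuous_comp _ _ _ -%R expR); [exact: opp_continuous|exact: continuous_expR].
Qed.

(** The odd terms of the exponential series cancel, so the series is grouped by
pairs of consecutive terms. *)
Lemma cvg_coshR y :
  series (fun j => y ^+ j.*2 / (j.*2)`!%:R) @ \oo --> coshR y.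
Proof.
pose f := (fun n => (exp_coeff y n + exp_coeff (- y) n) / 2) : R^nat.
have sf : series f @ \oo --> coshR y.
  have -> : series f = (fun n => (series (exp_coeff y) n + series (exp_coeff (- y)) n) / 2).
    apply/funext => n; rewrite /series/= -big_split/= mulr_suml.
    by apply: eq_bigr.
  apply: cvgM; last exact: cvg_cst.
  by apply: cvgD; exact: is_cvg_series_exp_coeff.
have cf : cvgn (series f) by apply/cvg_ex; exists (coshR y).
have := @cvg_series_cvg_series_group _ _ 2 cf isT.
rewrite (cvg_lim _ sf)//; apply: cvg_trans.
suff -> : (fun j => y ^+ j.*2 / (j.*2)`!%:R) =
  (fun n => \sum_(n * 2 <= i < n.+1 * 2) f i) by [].
apply/funext => n; rewrite !muln2 doubleS big_nat_recl// big_nat1 /f /exp_coeff/=.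
rewrite !(exprNn y) -(signr_odd _ n.*2) -(signr_odd _ n.*2.+1)/= odd_double/= expr0 expr1.
by field; rewrite !pnatr_eq0 -!lt0n !fact_gt0.
Qed.

Lemma coshR_partial_sum_le y N :
  \sum_(0 <= j < N) `|y| ^+ j.*2 / (j.*2)`!%:R <= coshR y.
Proof.
have -> : coshR y = coshR `|y|.
  by case: (ger0P y) => // _; rewrite coshRN.
have h := @cvg_coshR `|y|.
rewrite -(cvg_lim _ h)//.
apply: nondecreasing_cvgn_le; last by apply/cvg_ex; eexists; exact: h.
apply/nondecreasing_seqP => n; rewrite seriesSr lerDl.
by rewrite mulr_ge0// ?exprn_ge0// invr_ge0.
Qed.

(** [cos (t * sqrt x)], continued to negative [x]. *)
Definition cosq t x : R := cos (t * Num.sqrt x) * coshR (t * Num.sqrt (- x)).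

Lemma cosq_ge0 t x : 0 <= x -> cosq t x = cos (t * Num.sqrt x).
Proof.
by move=> x0; rewrite /cosq (@ler0_sqrtr _ (- x)) ?oppr_le0// mulr0 coshR0 mulr1.
Qed.

Lemma cosq_le0 t x : x <= 0 -> cosq t x = coshR (t * Num.sqrt (- x)).
Proof. by move=> x0; rewrite /cosq (ler0_sqrtr x0) mulr0 cos0 mul1r. Qed.

Lemma cosq0 x : cosq 0 x = 1.
Proof. by rewrite /cosq !mul0r cos0 coshR0 mulr1. Qed.

Lemma cosqDB s t x : cosq (s + t) x + cosq (s - t) x = 2 * cosq s x * cosq t x.
Proof.
have [x0|/ltW x0] := leP 0 x.
  rewrite !cosq_ge0// mulrBl mulrDl cosB cosD; lra.
by rewrite !cosq_le0// mulrBl mulrDl coshRDB.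
Qed.

Lemma norm_cosq_le1 t x : 0 <= x -> `|cosq t x| <= 1.
Proof. by move=> x0; rewrite cosq_ge0// cos_max. Qed.

Lemma cosq_ge1 t x : x <= 0 -> 1 <= cosq t x.
Proof. by move=> x0; rewrite cosq_le0// coshR_ge1. Qed.

Lemma measurable_cosq t : measurable_fun setT (cosq t).
Proof.
apply: continuous_measurable_fun => x.
have cs (f : R -> R) : continuous f -> {for x, continuous (fun x => Num.sqrt (f x))}.
  by move=> cf; apply: continuous_comp; [exact: cf|exact: sqrt_continuous].
apply: cvgM.
  apply: continuous_comp; last exact: continuous_cos.
  by apply: cvgM; [exact: cvg_cst|apply: (cs id) => ?; exact: cvg_id].
apply: (@continuous_comp _ _ _ (fun x => t * Num.sqrt (- x)) coshR).
  by apply: cvgM; [exact: cvg_cst|apply: (cs -%R) => ?; exact: opp_continuous].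
exact: continuous_coshR.
Qed.

Definition cosq_term t x (j : nat) : R := (-1) ^+ j * t ^+ j.*2 * x ^+ j / (j.*2)`!%:R.

Lemma cvg_cosq t x : series (cosq_term t x) @ \oo --> cosq t x.
Proof.
have [x0|/ltW x0] := leP 0 x.
  rewrite cosq_ge0//.
  suff -> : cosq_term t x = cos_coeff' (t * Num.sqrt x) by exact: cvg_cos_coeff'.
  apply/funext => j; rewrite /cosq_term /cos_coeff' exprMn -[in Num.sqrt x ^+ _]mul2n exprM.
  by rewrite sqr_sqrtr// mulrA exprnP.
rewrite cosq_le0//.
suff -> : cosq_term t x = (fun j => (t * Num.sqrt (- x)) ^+ j.*2 / (j.*2)`!%:R).
  exact: cvg_coshR.
apply/funext => j; rewrite /cosq_term exprMn -[in Num.sqrt _ ^+ _]mul2n exprM.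
rewrite sqr_sqrtr ?oppr_ge0// (exprNn x) [in LHS](mulrC (_ ^+ j)).
by rewrite mulrA.
Qed.

(** The dominating function of the termwise integration of [cosq]. *)
Lemma norm_cosq_partial_sum_le t x N :
  `|\sum_(0 <= j < N) cosq_term t x j| <= coshR (t * Num.sqrt `|x|).
Proof.
apply: le_trans (ler_norm_sum _ _ _) _.
apply: le_trans (coshR_partial_sum_le _ N).
apply: ler_sum => j _; rewrite /cosq_term !normrM normfV normr_nat.
rewrite !normrX normrN1 expr1n mul1r exprMn (ger0_norm (sqrtr_ge0 _)).
by rewrite -[X in Num.sqrt _ ^+ X]mul2n exprM sqr_sqrtr.
Qed.

End square_root_cosine.

(** * Integrability of real-valued functions *)

Lemma integrable_le d (T : measurableType d) (R : realType)
    (mu : {measure set T -> \bar R}) (D : set T) (f g : T -> R) :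
  measurable D -> measurable_fun D f -> (forall x, D x -> `|f x| <= g x) ->
  mu.-integrable D (EFin \o g) -> mu.-integrable D (EFin \o f).
Proof.
move=> mD mf fg; apply: le_integrable => //; first exact/measurable_EFinP.
by move=> x Dx /=; rewrite lee_fin (le_trans (fg x Dx))// ler_norm.
Qed.

Lemma integrable_lt_pinfty d (T : measurableType d) (R : realType)
    (mu : {measure set T -> \bar R}) (D : set T) (f : T -> R) :
  measurable D -> measurable_fun D f -> (forall x, D x -> 0 <= f x) ->
  (\int[mu]_(x in D) (f x)%:E < +oo)%E -> mu.-integrable D (EFin \o f).
Proof.
move=> mD mf f0 foo; apply/integrableP; split; first exact/measurable_EFinP.
apply: le_lt_trans foo; apply: ge0_le_integral => //.
- by apply: measurableT_comp => //; exact/measurable_EFinP.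
- exact/measurable_EFinP.
- by move=> x Dx /=; rewrite ger0_norm// f0.
Qed.

(** * Exponential integrability from factorial moments *)

Lemma fact_double_add (k j : nat) :
  (((k + j).*2)`! <= 4 ^ (k + j) * (k.*2)`! * (j.*2)`!)%N.
Proof.
rewrite doubleD; set a := k.*2; set b := j.*2.
have ab : (a <= a + b)%N by rewrite leq_addr.
rewrite -(bin_fact ab) addKn -mulnA leq_mul2r; apply/orP; right.
rewrite (_ : 4 = 2 ^ 2)%N// -expnM mul2n doubleD -/a -/b.
rewrite -[X in (_ <= X ^ _)%N](addn1 1) expnDn (bigD1 (Ordinal (_ : a < (a + b).+1)%N))//=.
by rewrite !exp1n !muln1 leq_addr.
Qed.

Lemma fact_quadruple (k : nat) : (((k.*2).*2)`! <= (4 ^ k * (k.*2)`!) ^ 2)%N.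
Proof.
have := fact_double_add k k; rewrite addnn => /leq_trans; apply.
by rewrite expnMn -expnM muln2 -mulnA leq_mul2l -mulnn leqnn orbT.
Qed.

Section growth.
Context {R : realType}.
Variables (mu : {measure set R -> \bar R}) (phi : R -> R) (M D h : R).
Hypothesis phi_meas : measurable_fun setT phi.
Hypothesis phi_ge0 : forall x, 0 <= phi x.
Hypothesis phi_mom : forall k : nat,
  (\int[mu]_x (phi x * `|x| ^+ k)%:E <= (M * D ^+ k * (k.*2)`!%:R)%:E)%E.
Hypotheses (M_ge0 : 0 <= M) (D_ge0 : 0 <= D) (hD : 8 * D * h ^+ 2 <= 1).

(** Termwise integration of the series of [cosh]: since [(2 (k + j))!] is at most
[4 ^ (k + j) * (2 k)! * (2 j)!], the [j]-th integral is bounded by a multiple of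
[(4 * D * h ^ 2) ^ j], a geometric term of ratio at most [1 / 2]. *)
Lemma integrable_coshR_sqrt (k : nat) :
  mu.-integrable setT
    (EFin \o (fun x => phi x * `|x| ^+ k * coshR (h * Num.sqrt `|x|))).
Proof.
pose term j x : R := phi x * `|x| ^+ (k + j) * (`|h| ^+ j.*2 / (j.*2)`!%:R).
have mpow j : measurable_fun setT (fun x : R => phi x * `|x| ^+ j).
  by apply: measurable_funM => //; apply: measurable_funX; exact: normr_measurable.
have term_ge0 j x : 0 <= term j x.
  by rewrite /term !mulr_ge0// ?exprn_ge0// invr_ge0.
have mterm j : measurable_fun setT (term j).
  by rewrite /term; apply: measurable_funM.
have termE x : ((phi x * `|x| ^+ k * coshR (h * Num.sqrt `|x|))%:E =
    \sum_(j <oo) (term j x)%:E)%E.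
  apply/esym/cvg_lim => //.
  rewrite (_ : (fun n => _) = EFin \o (fun n => phi x * `|x| ^+ k *
      \sum_(0 <= j < n) (h * Num.sqrt `|x|) ^+ j.*2 / (j.*2)`!%:R)); last first.
    apply/funext => n /=; rewrite sumEFin; congr EFin; rewrite mulr_sumr.
    apply: eq_bigr => j _; rewrite /term exprD exprMn -[in Num.sqrt _ ^+ _]mul2n exprM.
    rewrite sqr_sqrtr// -[in `|h| ^+ _]mul2n exprM real_normK ?num_real//.
    rewrite -exprM mul2n; ring.
  apply: cvg_EFin; first exact: nearW.
  by apply: cvgM; [exact: cvg_cst|exact: cvg_coshR].
apply: integrable_lt_pinfty => //.
- apply: measurable_funM => //; apply: measurableT_comp.
    exact: continuous_measurable_fun continuous_coshR.
  apply: measurable_funM => //; apply: measurableT_comp => //.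
  by apply: continuous_measurable_fun => ?; exact: sqrt_continuous.
- move=> x _; rewrite mulr_ge0 ?mulr_ge0 ?exprn_ge0//.
under eq_integral do rewrite termE.
rewrite integral_nneseries//; last 2 first.
- by move=> j; exact/measurable_EFinP.
- by move=> j x _; rewrite lee_fin.
pose B := M * (4 * D) ^+ k * (k.*2)`!%:R.
have B_ge0 : 0 <= B by rewrite /B !mulr_ge0// exprn_ge0// mulr_ge0.
have bnd j : (\int[mu]_x (term j x)%:E <= (B * (2^-1) ^+ j)%:E)%E.
  rewrite /term; under eq_integral do rewrite EFinM.
  rewrite ge0_integralZr//; last 2 first.
  - exact/measurable_EFinP.
  - by move=> x _; rewrite lee_fin mulr_ge0// exprn_ge0.
  apply: (@le_trans _ _ ((M * D ^+ (k + j) * ((k + j).*2)`!%:R)%:E *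
     (`|h| ^+ j.*2 / (j.*2)`!%:R)%:E)%E).
    by rewrite lee_wpmul2r// lee_fin mulr_ge0// ?exprn_ge0// invr_ge0.
  rewrite -EFinM lee_fin.
  have f0 : 0 < (j.*2)`!%:R :> R by rewrite ltr0n fact_gt0.
  rewrite mulrA ler_pdivrMr//.
  have -> : `|h| ^+ j.*2 = (h ^+ 2) ^+ j.
    by rewrite -mul2n exprM real_normK// num_real.
  apply: (@le_trans _ _ (M * D ^+ (k + j) *
    (4 ^+ (k + j) * (k.*2)`!%:R * (j.*2)`!%:R) * (h ^+ 2) ^+ j)).
    apply: ler_wpM2r; first by rewrite exprn_ge0// sqr_ge0.
    apply: ler_wpM2l; first by rewrite mulr_ge0// exprn_ge0.
    by rewrite -natrX -!natrM ler_nat fact_double_add.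
  have -> : M * D ^+ (k + j) * (4 ^+ (k + j) * (k.*2)`!%:R * (j.*2)`!%:R) *
     (h ^+ 2) ^+ j = B * (4 * D * h ^+ 2) ^+ j * (j.*2)`!%:R.
    rewrite /B !exprMn !exprD; ring.
  apply: ler_wpM2r; first exact: ltW.
  apply: ler_wpM2l => //; apply: lerXn2r; rewrite ?nnegrE//.
    by rewrite mulr_ge0 ?sqr_ge0// mulr_ge0.
  by move: hD; rewrite -!mulrA; move: (D * _) => y; lra.
apply: (@le_lt_trans _ _ (2 * B)%:E); last exact: ltry.
apply: lime_le.
  by apply: is_cvg_nneseries => j _ _; apply: integral_ge0 => x _; rewrite lee_fin.
apply: nearW => n.
apply: (@le_trans _ _ (\sum_(0 <= j < n) (B * (2^-1) ^+ j)%:E)%E).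
  exact: lee_sum.
rewrite sumEFin lee_fin -mulr_sumr mulrC ler_wpM2r//.
have : \sum_(0 <= j < n) (2^-1 : R) ^+ j = 2 * (1 - 2^-1 ^+ n).
  elim: n => [|n ih]; first by rewrite big_nil expr0 subrr mulr0.
  by rewrite big_nat_recr//= ih exprS; field.
move=> ->; have := exprn_ge0 n (_ : 0 <= 2^-1 :> R); move/(_ (ltac:(lra))) => ?; lra.
Qed.

End growth.

(** * Integrals of real-valued functions *)

Lemma EFin_Rintegral d (T : measurableType d) (R : realType)
    (mu : {measure set T -> \bar R}) (D : set T) (f : T -> R) :
  measurable D -> mu.-integrable D (EFin \o f) ->
  (\int[mu]_(x in D) (f x)%:E = (\int[mu]_(x in D) f x)%R%:E)%E.
Proof. by move=> mD intf; rewrite fineK//; exact: integrable_fin_num. Qed.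

Lemma integrable_measurable d (T : measurableType d) (R : realType)
    (mu : {measure set T -> \bar R}) (D : set T) (f : T -> R) :
  mu.-integrable D (EFin \o f) -> measurable_fun D f.
Proof. by move=> /integrableP[/measurable_EFinP]. Qed.

Lemma integrable_EFinD d (T : measurableType d) (R : realType)
    (mu : {measure set T -> \bar R}) (D : set T) (f g : T -> R) :
  measurable D ->
  mu.-integrable D (EFin \o f) -> mu.-integrable D (EFin \o g) ->
  mu.-integrable D (EFin \o (fun x => f x + g x)).
Proof. by move=> mD intf intg; exact: (integrableD mD intf intg). Qed.

Lemma integrable_EFinZ d (T : measurableType d) (R : realType)
    (mu : {measure set T -> \bar R}) (D : set T) (f : T -> R) (c : R) :
  measurable D ->
  mu.-integrable D (EFin \o f) -> mu.-integrable D (EFin \o (fun x => c * f x)).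
Proof. by move=> mD intf; exact: (integrableZl mD c intf). Qed.

(** The larger function is replaced by [max f g], which equals it almost
everywhere and dominates [f] everywhere. *)
Lemma ae_le_Rintegral d (T : measurableType d) (R : realType)
    (mu : {measure set T -> \bar R}) (f g : T -> R) :
  mu.-integrable setT (EFin \o f) -> mu.-integrable setT (EFin \o g) ->
  {ae mu, forall x, f x <= g x} ->
  \int[mu]_x f x <= \int[mu]_x g x.
Proof.
move=> intf intg fg.
have mf := integrable_measurable intf; have mg := integrable_measurable intg.
pose g' x := Num.max (f x) (g x).
have mg' : measurable_fun setT g' by exact: measurable_maxr.
have gg' : ae_eq mu setT (EFin \o g) (EFin \o g').
  by move: fg; apply: filterS => x fg _ /=; rewrite /g' max_r.
have intg' : mu.-integrable setT (EFin \o g').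
  apply: (integrable_le (g := fun x => `|f x| + `|g x|)) => //.
    move=> x _; rewrite /g'; case: (leP (f x) (g x)) => _.
      by rewrite lerDr.
    by rewrite lerDl.
  by apply: integrable_EFinD => //; exact: integrable_norm.
have -> : \int[mu]_x g x = \int[mu]_x g' x.
  by rewrite /Rintegral; congr fine; apply: ae_eq_integral => //; exact/measurable_EFinP.
by apply: le_Rintegral => // x _; rewrite /g' le_max lexx.
Qed.

(** * Functions with the same integral under two laws *)

Section agreement.
Context {R : realType}.
Variables Q mu : probability R R.
Implicit Types (f g : R -> R).

Definition agree f : Prop :=
  [/\ Q.-integrable setT (EFin \o f), mu.-integrable setT (EFin \o f) &
      \int[Q]_x f x = \int[mu]_x f x].

Lemma agree_measurable f : agree f -> measurable_fun setT f.
Proof. by case=> /integrable_measurable. Qed.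

Lemma agree_cst (c : R) : agree (fun=> c).
Proof.
split; [exact: finite_measure_integrable_cst..|].
suff E (P : probability R R) : \int[P]_x c = c by rewrite !E.
by rewrite (Rintegral_cst P measurableT c) /= probability_setT mulr1.
Qed.

Lemma agreeD f g : agree f -> agree g -> agree (fun x => f x + g x).
Proof.
move=> [Qf mf fE] [Qg mg gE]; split; last by rewrite !RintegralD// fE gE.
- exact: integrable_EFinD.
- exact: integrable_EFinD.
Qed.

Lemma agreeZ (c : R) f : agree f -> agree (fun x => c * f x).
Proof.
move=> [Qf mf fE]; split; last by rewrite !RintegralZl// fE.
- exact: integrable_EFinZ.
- exact: integrable_EFinZ.
Qed.

Lemma agreeB f g : agree f -> agree g -> agree (fun x => f x - g x).
Proof.
move=> Af /(agreeZ (-1)) /(agreeD Af).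
by congr agree; apply/funext => x; rewrite mulN1r.
Qed.

Lemma agree_sum (F : nat -> R -> R) n : (forall j, agree (F j)) ->
  agree (fun x => \sum_(0 <= j < n) F j x).
Proof.
move=> AF; elim: n => [|n ih].
  rewrite (_ : (fun x => _) = (fun=> 0)); first exact: agree_cst.
  by apply/funext => x; rewrite big_nil.
rewrite (_ : (fun x => _) = (fun x => \sum_(0 <= j < n) F j x + F n x)).
  exact: agreeD.
by apply/funext => x; rewrite big_nat_recr.
Qed.

Lemma agree_lim (F : nat -> R -> R) f g :
  (forall n, agree (F n)) -> measurable_fun setT f ->
  Q.-integrable setT (EFin \o g) -> mu.-integrable setT (EFin \o g) ->
  {ae Q, forall x, F ^~ x @ \oo --> f x} ->
  {ae mu, forall x, F ^~ x @ \oo --> f x} ->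
  {ae Q, forall x n, `|F n x| <= g x} ->
  {ae mu, forall x n, `|F n x| <= g x} ->
  agree f.
Proof.
move=> AF mf Qg mg FfQ Ffm FgQ Fgm.
have dom (P : probability R R) (intg : P.-integrable setT (EFin \o g)) :
    {ae P, forall x, F ^~ x @ \oo --> f x} ->
    {ae P, forall x n, `|F n x| <= g x} ->
    P.-integrable setT (EFin \o f) /\
    (fun n => \int[P]_x (F n x)%:E)%E @ \oo --> (\int[P]_x (f x)%:E)%E.
  move=> Ff Fg.
  have [] := @dominated_convergence _ _ _ P setT measurableT
    (fun n => EFin \o F n) (EFin \o f) (EFin \o g) _ _ _ intg _ => //.
  - by move=> n; apply/measurable_EFinP; exact: agree_measurable.
  - exact/measurable_EFinP.
  - move: Ff; apply: filterS => x Fx _.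
    by apply: cvg_EFin => //; exact: nearW.
  - by move: Fg; apply: filterS => x Fx n _ /=; rewrite lee_fin.
have [Qf cQ] := dom Q Qg FfQ FgQ.
have [mf' cm] := dom mu mg Ffm Fgm.
split => //; rewrite /Rintegral; congr fine.
suff E : (fun n => \int[Q]_x (F n x)%:E)%E = (fun n => \int[mu]_x (F n x)%:E)%E.
  by rewrite -(cvg_lim (@ereal_hausdorff _) cQ) E; apply: cvg_lim.
apply/funext => n; have [Q1 m1] := AF n.
by rewrite !EFin_Rintegral// => ->.
Qed.

End agreement.

(** * Moments of a half-line law and a competitor on the whole line *)

Section hamburger_extension.
Context {R : realType}.
Variables (Q mu : probability R R) (D : R).
Hypothesis mu_ge0 : {ae mu, forall x : R, 0 <= x}.
Hypothesis D_ge0 : 0 <= D.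
Hypothesis mu_mom : forall k : nat,
  (\int[mu]_x (`|x| ^+ k)%:E <= (D ^+ k * (k.*2)`!%:R)%:E)%E.
Hypothesis same_mom : forall k : nat, agree Q mu (fun x => x ^+ k).

Let mX (k : nat) : measurable_fun setT (fun x : R => x ^+ k).
Proof. exact: agree_measurable (same_mom k). Qed.

Lemma measurable_normX (k : nat) : measurable_fun setT (fun x : R => `|x| ^+ k).
Proof. by apply: measurable_funX; exact: normr_measurable. Qed.

Lemma integrable_normX (P : probability R R) (k : nat) :
  P.-integrable setT (EFin \o (fun x : R => x ^+ k)) ->
  P.-integrable setT (EFin \o (fun x : R => `|x| ^+ k)).
Proof.
move=> intX; apply: (integrable_le (g := fun x : R => `|x ^+ k|)) => //.
- exact: measurable_normX.
- by move=> x _; rewrite !normrX normr_id.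
- exact: integrable_norm.
Qed.

(** Cauchy-Schwarz against the moment of order [2 k], which is common to both
    laws, keeps the factorial growth of the absolute moments of [Q]. *)
Lemma abs_moment_le (k : nat) :
  \int[Q]_x (`|x| ^+ k) <= (4 * D) ^+ k * (k.*2)`!%:R.
Proof.
set s := (4 * D) ^+ k * (k.*2)`!%:R.
have [Q2 mu2 E2] := same_mom k.*2.
have normX2 (x : R) : `|x| ^+ k.*2 = x ^+ k.*2.
  by rewrite -mul2n !exprM real_normK ?num_real.
have m2 : \int[mu]_x (x ^+ k.*2) <= s ^+ 2.
  rewrite -lee_fin -EFin_Rintegral//.
  under eq_integral do rewrite -normX2.
  apply: le_trans (mu_mom _) _; rewrite lee_fin /s.
  have : ((k.*2).*2)`!%:R <= (4 ^+ k * (k.*2)`!%:R) ^+ 2 :> R.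
    by rewrite -natrX -natrM -natrX ler_nat fact_quadruple.
  move=> /(ler_wpM2l (exprn_ge0 k.*2 D_ge0)) /le_trans; apply.
  rewrite -{1}mul2n mulnC exprM -exprMn le_eqVlt; apply/orP; left; apply/eqP.
  by rewrite mulrA (exprMn k 4) [D ^+ k * _]mulrC.
have s_ge0 : 0 <= s by rewrite mulr_ge0// exprn_ge0// mulr_ge0.
(* [y <= s' / 2 + y ^ 2 / (2 s')], where the slack [e] keeps [s'] positive *)
apply/ler_addgt0Pl => e e0; set s' := e + s.
have s'0 : 0 < s' by rewrite /s'; lra.
apply: (@le_trans _ _ (\int[Q]_x (s' / 2 + (2 * s')^-1 * x ^+ k.*2))).
  apply: le_Rintegral => //.
  - by apply: integrable_normX; have [] := same_mom k.
  - have [] := agreeD (agree_cst Q mu (s' / 2)) (agreeZ (2 * s')^-1 (same_mom k.*2)).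
    by [].
  - move=> x _; rewrite -normX2 -mul2n mulnC exprM.
    move: (`|x| ^+ k) => y; rewrite invfM.
    have -> : s' / 2 + 2^-1 / s' * y ^+ 2 = y + (s' - y) ^+ 2 / (2 * s').
      by field; rewrite gt_eqF.
    by rewrite lerDl divr_ge0 ?sqr_ge0// mulr_ge0// ltW.
have [QA muA ->] := agreeD (agree_cst Q mu (s' / 2)) (agreeZ (2 * s')^-1 (same_mom k.*2)).
rewrite RintegralD//; last 2 first.
  by have [] := agree_cst Q mu (s' / 2).
  exact: integrable_EFinZ.
rewrite (Rintegral_cst mu measurableT) /= probability_setT mulr1 RintegralZl//.
have ss : s ^+ 2 <= s' ^+ 2 by rewrite lerXn2r ?nnegrE//; rewrite /s'; lra.
have := le_trans m2 ss; move: (\int[mu]_x _) => I Is.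
rewrite -[leRHS](_ : s' / 2 + (2 * s')^-1 * s' ^+ 2 = s'); last first.
  by field; rewrite gt_eqF.
by rewrite lerD2l ler_wpM2l// invr_ge0 mulr_ge0// ltW.
Qed.

Lemma abs_moment_le_mu (k : nat) :
  \int[mu]_x (`|x| ^+ k) <= (4 * D) ^+ k * (k.*2)`!%:R.
Proof.
rewrite -lee_fin -EFin_Rintegral//; last first.
  by apply: integrable_normX; have [] := same_mom k.
apply: le_trans (mu_mom _) _; rewrite lee_fin ler_wpM2r// lerXn2r ?nnegrE//.
  by rewrite mulr_ge0.
by rewrite ler_peMl// ler1n.
Qed.

Definition agree_cosq t := forall k : nat, agree Q mu (fun x => x ^+ k * cosq t x).

Lemma agree_cosq0 : agree_cosq 0.
Proof.
move=> k; have := same_mom k; congr agree; apply/funext => x.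
by rewrite cosq0 mulr1.
Qed.

(** On the negative half-line [cosq t] is positive and [x ^+ k] has constant
    sign, so the integral of the absolute value over it is controlled by signed
    integrals, which agree. *)
Lemma abs_cosq_moment_le t (k : nat) : agree_cosq t ->
  forall P : probability R R, P = Q \/ P = mu ->
  (\int[P]_x (`|cosq t x| * `|x| ^+ k)%:E <=
    (3 * (4 * D) ^+ k * (k.*2)`!%:R)%:E)%E.
Proof.
move=> St P PE; have [QS muS SE] := St k.
have [intQ intmu _] := same_mom k.
have muk : \int[mu]_x ((-1) ^+ k * (x ^+ k * cosq t x)) <= (4 * D) ^+ k * (k.*2)`!%:R.
  apply: le_trans (abs_moment_le_mu k); apply: ae_le_Rintegral.
  - exact: integrable_EFinZ.
  - exact: integrable_normX.
  - move: mu_ge0; apply: filterS => x x0.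
    apply: le_trans (ler_norm _) _; rewrite normrM normrX normrN1 expr1n mul1r.
    by rewrite normrM normrX ler_piMr ?exprn_ge0// norm_cosq_le1.
have [intP [intPS [PS Pk]]] : P.-integrable setT (EFin \o (fun x : R => x ^+ k)) /\
   P.-integrable setT (EFin \o (fun x : R => x ^+ k * cosq t x)) /\
   \int[P]_x (x ^+ k * cosq t x) = \int[mu]_x (x ^+ k * cosq t x) /\
   \int[P]_x (`|x| ^+ k) <= (4 * D) ^+ k * (k.*2)`!%:R.
  case: PE => ->; split => //; split => //; split => //.
    exact: abs_moment_le.
  exact: abs_moment_le_mu.
have intA : P.-integrable setT
    (EFin \o (fun x => (-1) ^+ k * (x ^+ k * cosq t x) + 2 * `|x| ^+ k)).
  apply: integrable_EFinD => //; apply: integrable_EFinZ => //.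
  exact: integrable_normX.
have ptw x : `|cosq t x| * `|x| ^+ k <=
    (-1) ^+ k * (x ^+ k * cosq t x) + 2 * `|x| ^+ k.
  have ak : 0 <= `|x| ^+ k by rewrite exprn_ge0.
  have [x0|x0] := leP 0 x.
    have : `|(-1) ^+ k * (x ^+ k * cosq t x)| <= `|x| ^+ k.
      rewrite normrM normrX normrN1 expr1n mul1r.
      by rewrite normrM normrX ler_piMr ?exprn_ge0// norm_cosq_le1.
    rewrite ler_norml => /andP[+ _].
    have : `|cosq t x| * `|x| ^+ k <= `|x| ^+ k by rewrite ler_piMl// norm_cosq_le1.
    lra.
  have c1 := cosq_ge1 t (ltW x0).
  rewrite mulrA -exprMn mulN1r -(ltr0_norm x0) (ger0_norm (le_trans ler01 c1)).
  by rewrite mulrC lerDl mulr_ge0.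
have mabs : measurable_fun setT (fun x => `|cosq t x| * `|x| ^+ k).
  apply: measurable_funM; last exact: measurable_normX.
  by apply: measurableT_comp => //; exact: measurable_cosq.
apply: (@le_trans _ _ (\int[P]_x ((-1) ^+ k * (x ^+ k * cosq t x) + 2 * `|x| ^+ k)%:E)%E).
  apply: ge0_le_integral => //.
  - exact/measurable_EFinP.
  - by apply/measurable_EFinP; exact: integrable_measurable intA.
  - by move=> x _; rewrite lee_fin.
rewrite EFin_Rintegral// lee_fin RintegralD//; last 2 first.
- exact: integrable_EFinZ.
- by apply: integrable_EFinZ => //; exact: integrable_normX.
rewrite RintegralZl// RintegralZl//; last exact: integrable_normX.
rewrite PS -RintegralZl//.
rewrite -mulrA; lra.
Qed.

(** The power series of [cosq h] is integrated termwise against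
[x ^ k * cosq t x]; the step [h] has to be small, but the bound on it does not
depend on [t]. *)
Lemma agree_cosqM t h : 32 * D * h ^+ 2 <= 1 -> agree_cosq t ->
  forall k : nat, agree Q mu (fun x => x ^+ k * cosq t x * cosq h x).
Proof.
move=> hD St k.
have D4 : 0 <= 4 * D by rewrite mulr_ge0.
have hD4 : 8 * (4 * D) * h ^+ 2 <= 1 by rewrite mulrA -natrM.
have mcos : measurable_fun setT (fun x => `|cosq t x|).
  by apply: measurableT_comp => //; exact: measurable_cosq.
have intG P : P = Q \/ P = mu -> P.-integrable setT
    (EFin \o (fun x => `|cosq t x| * `|x| ^+ k * coshR (h * Num.sqrt `|x|))).
  move=> PE; apply: (integrable_coshR_sqrt (M := 3) (D := 4 * D)) => // j.
  exact: abs_cosq_moment_le.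
apply: (agree_lim (F := fun n x => \sum_(0 <= j < n) x ^+ k * cosq t x * cosq_term h x j)
   (g := fun x => `|cosq t x| * `|x| ^+ k * coshR (h * Num.sqrt `|x|))).
- move=> n; apply: agree_sum => j.
  have := agreeZ ((-1) ^+ j * h ^+ j.*2 / (j.*2)`!%:R) (St (k + j)%N).
  by congr agree; apply/funext => x; rewrite /cosq_term exprD; ring.
- apply: measurable_funM; last exact: measurable_cosq.
  exact: agree_measurable (St k).
- by apply: intG; left.
- by apply: intG; right.
- apply: aeW => x; under eq_fun do rewrite -mulr_sumr.
  by apply: cvgM; [exact: cvg_cst|exact: cvg_cosq].
- apply: aeW => x; under eq_fun do rewrite -mulr_sumr.
  by apply: cvgM; [exact: cvg_cst|exact: cvg_cosq].
- apply: aeW => x n; rewrite -mulr_sumr normrM ler_pM//.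
    by rewrite normrM normrX mulrC.
  exact: norm_cosq_partial_sum_le.
- apply: aeW => x n; rewrite -mulr_sumr normrM ler_pM//.
    by rewrite normrM normrX mulrC.
  exact: norm_cosq_partial_sum_le.
Qed.

(** The recurrence [cosq (t + h) = 2 cosq t cosq h - cosq (t - h)] propagates
    the agreement by steps of a fixed size. *)
Lemma agree_cosqT t : agree_cosq t.
Proof.
have [n tn] : exists n : nat, 32 * D * (t / n.+1%:R) ^+ 2 <= 1.
  have [n nb] : exists n : nat, 32 * D * t ^+ 2 <= n%:R.
    exists (Num.bound (32 * D * t ^+ 2)); apply/ltW/archi_boundP.
    by rewrite mulr_ge0 ?sqr_ge0// mulr_ge0.
  exists n; rewrite expr_div_n mulrA ler_pdivrMr ?exprn_gt0// mul1r.
  apply: le_trans nb _; rewrite -natrX ler_nat.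
  by rewrite (leq_trans (leqnSn n))// -mulnn leq_pmulr.
set h := t / n.+1%:R in tn.
suff S j : agree_cosq (j%:R * h) /\ agree_cosq (j.+1%:R * h).
  have -> : t = n.+1%:R * h by rewrite /h mulrC divfK// pnatr_eq0.
  exact: (S n).2.
elim: j => [|j [Sj Sj1]].
  rewrite mul0r mul1r; split; first exact: agree_cosq0.
  move=> k; have := agree_cosqM tn agree_cosq0 k; congr agree; apply/funext => x.
  by rewrite cosq0 mulr1.
split; [exact: Sj1|move=> k].
have := agreeB (agreeZ 2 (agree_cosqM tn Sj1 k)) (Sj k).
congr agree; apply/funext => x.
have := cosqDB (j.+1%:R * h) h x.
have -> : j.+1%:R * h + h = j.+2%:R * h by rewrite -(natr1 j.+1) mulrDl mul1r.
have -> : j.+1%:R * h - h = j%:R * h by rewrite -(natr1 j) mulrDl mul1r addrK.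
move=> /(congr1 (fun y => y - cosq (j%:R * h) x)); rewrite addrK => ->; ring.
Qed.

(** [cosq t] is bounded by [1] on the half-line that carries [mu], but at least
[cosh (t * sqrt e)] on [x <= - e]: a positive [Q]-mass there would make the
common integral exceed [1] for large [t]. *)
Lemma ae_ge0_of_agree : {ae Q, forall x : R, 0 <= x}.
Proof.
have mN (e : R) : measurable `]-oo, e]%classic by exact: measurable_itv.
have Qe (e : R) : 0 < e -> Q `]-oo, - e]%classic = 0%E.
  move=> e0; pose A : set R := `]-oo, - e]%classic; rewrite -/A.
  have mA : measurable A by exact: mN.
  have Afin : Q A \is a fin_num by exact: fin_num_measure.
  rewrite -(fineK Afin); congr EFin; apply/eqP; rewrite eq_le fine_ge0 ?measure_ge0// andbT.
  rewrite leNgt; apply/negP => qpos.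
  pose q := fine (Q A).
  (* with [cosh y >= y / 2] the integral is at least [t sqrt e q / 2 - 1 = 2] *)
  pose t := 6 / (q * Num.sqrt e).
  have se : 0 < Num.sqrt e by rewrite sqrtr_gt0.
  have tq : t * Num.sqrt e * q = 6 by rewrite /t /q; field; rewrite !gt_eqF.
  have [intQ intmu E] := agree_cosqT t 0%N.
  have Emu : \int[mu]_x (x ^+ 0 * cosq t x) <= 1.
    have -> : 1 = \int[mu]_x (1 : R).
      by rewrite (Rintegral_cst mu measurableT) /= probability_setT mulr1.
    apply: ae_le_Rintegral => //; first by have [] := agree_cst Q mu 1.
    move: mu_ge0; apply: filterS => x x0.
    by rewrite expr0 mul1r (le_trans (ler_norm _))// norm_cosq_le1.
  rewrite -E in Emu.
  have iA : Q.-integrable setT (EFin \o (fun x => (t * Num.sqrt e / 2) * \1_A x - 1)).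
    apply: (integrable_EFinD _ (integrable_EFinZ _ _ _)) => //.
      exact: integrable_indic.
    by have [] := agree_cst Q mu (-1).
  have : \int[Q]_x ((t * Num.sqrt e / 2) * \1_A x - 1) <= 1.
    apply: le_trans Emu; apply: le_Rintegral => // x _.
    rewrite expr0 mul1r indicE; case: (boolP (x \in A)) => [|_] /=.
      rewrite inE /A/= in_itv/= => xe.
      have x0 : x <= 0 by lra.
      rewrite mulr1 cosq_le0// /coshR.
      have tpos : 0 <= t by rewrite /t divr_ge0// mulr_ge0 ?fine_ge0// sqrtr_ge0.
      have : t * Num.sqrt e <= t * Num.sqrt (- x).
        by rewrite ler_wpM2l// ler_wsqrtr//; lra.
      have := expR_ge1Dx (t * Num.sqrt (- x)).
      have := expR_ge0 (- (t * Num.sqrt (- x))).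
      by move: (t * Num.sqrt e) (t * Num.sqrt (- x)) (expR (- _)) (expR (t * _)) => *; lra.
    rewrite mulr0 sub0r; have [x0|/ltW x0] := leP 0 x.
      by have := norm_cosq_le1 t x0; rewrite ler_norml => /andP[].
    by have := cosq_ge1 t x0; lra.
  rewrite RintegralD//; last 2 first.
  - by apply: integrable_EFinZ => //; exact: integrable_indic.
  - by have [] := agree_cst Q mu (-1).
  rewrite RintegralZl//; last exact: integrable_indic.
  rewrite (Rintegral_cst Q measurableT) /= probability_setT mulr1.
  rewrite /Rintegral integral_indic// setIT -/q.
  have -> : t * Num.sqrt e / 2 * q = (t * Num.sqrt e * q) / 2 by ring.
  rewrite tq; lra.
rewrite /almost_everywhere /=.
apply: (@negligibleS _ _ _ _ (\bigcup_n `]-oo, - (n.+1%:R^-1 : R)]%classic)).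
  move=> x /= /negP; rewrite -ltNge => x0.
  exists (Num.bound (- x)^-1) => //=; rewrite in_itv/=.
  have mx : 0 < - x by lra.
  rewrite lerNr -[leRHS]invrK lef_pV2 ?posrE ?invr_gt0//.
  apply/ltW/(lt_trans (archi_boundP _)); first by rewrite invr_ge0 ltW.
  by rewrite ltr_nat.
apply: negligible_bigcup => n; exists `]-oo, - (n.+1%:R^-1 : R)]%classic; split => //.
by apply: Qe; rewrite invr_gt0.
Qed.

End hamburger_extension.

(** * Gaussians and indicators as limits of cosines and exponentials *)

Section elementary_bounds.
Context {R : realType}.
Implicit Types (z w : R).

Lemma cvg_harmonic_bound (u : R^nat) (l C : R) :
  (forall n, `|u n - l| <= C / n.+1%:R) -> u @ \oo --> l.
Proof.
move=> uC; apply/subr_cvg0; apply: norm_cvg0.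
have cC : (fun n => C / n.+1%:R) @ \oo --> (0 : R).
  by rewrite -(mulr0 C); apply: cvgM; [exact: cvg_cst|exact: cvg_harmonic].
apply: (@squeeze_cvgr _ _ _ _ (cst 0) _ _ _ _ _ cC); last exact: cvg_cst.
by apply: nearW => n; rewrite normr_ge0 uC.
Qed.

(** Iterated, it gives the Taylor bounds on [sin] and [cos] below. *)
Lemma MVT0 (f df : R -> R) z : 0 <= z -> (forall x : R, is_derive x 1 f (df x)) ->
  exists2 c : R, 0 <= c <= z & f z - f 0 = df c * z.
Proof.
move=> z0 fdf; have [|c cz] := @MVT_segment _ f df 0 z z0.
- by apply: derivable_within_continuous => x _; have [] := fdf x.
- by rewrite subr0 => E; exists c => //; move: cz; rewrite in_itv.
Qed.

Lemma sin_le z : 0 <= z -> sin z <= z.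
Proof.
move=> z0; have [c _] := MVT0 z0 (@is_derive_sin R); rewrite sin0 subr0 => ->.
by rewrite ler_piMl// cos_le1.
Qed.

Lemma cos_ge z : 0 <= z -> 1 - z ^+ 2 <= cos z.
Proof.
move=> z0; have [c /andP[c0 cz]] := MVT0 z0 (@is_derive_cos R); rewrite cos0.
move=> E; have -> : cos z = 1 - sin c * z by lra.
by have := sin_le c0; nra.
Qed.

Lemma sin_bounds z : 0 <= z -> z - z ^+ 3 <= sin z.
Proof.
move=> z0; have [c /andP[c0 cz]] := MVT0 z0 (@is_derive_sin R); rewrite sin0 subr0 => ->.
have := cos_ge c0.
have : c ^+ 2 <= z ^+ 2 by rewrite lerXn2r.
rewrite (_ : z - z ^+ 3 = (1 - z ^+ 2) * z); last by ring.
move=> h1 h2; rewrite ler_wpM2r//; lra.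
Qed.

Lemma cos_expR_dist z : 0 <= z -> `|cos z - expR (- (z ^+ 2 / 2))| <= 2 * z ^+ 4.
Proof.
move=> z0.
have cosz : 1 - z ^+ 2 / 2 <= cos z <= 1 - z ^+ 2 / 2 + z ^+ 4.
  have d (x : R) : is_derive x 1 (fun x : R => cos x - (1 - x ^+ 2 / 2)) (x - sin x).
    by apply: is_derive_eq; rewrite /GRing.scale/=; field.
  have [c /andP[c0 cz]] := MVT0 z0 d; rewrite cos0 expr0n/= mul0r subr0 subrr subr0.
  move=> E; have := sin_le c0; have := sin_bounds c0.
  have c3 : c ^+ 3 <= z ^+ 3 by rewrite lerXn2r.
  have -> : cos z = 1 - z ^+ 2 / 2 + (c - sin c) * z by rewrite -E; ring.
  move=> s1 s2; rewrite lerDl lerD2l mulr_ge0 ?subr_ge0//= exprSr ler_wpM2r//; lra.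
set w := z ^+ 2 / 2; have w0 : 0 <= w by rewrite divr_ge0// sqr_ge0.
have e1 : 1 - w <= expR (- w) by have := expR_ge1Dx (- w); lra.
have e2 : expR (- w) <= 1 - w + w ^+ 2.
  rewrite expRN; apply: (@le_trans _ _ (1 + w)^-1).
    by rewrite lef_pV2 ?posrE ?expR_gt0 ?expR_ge1Dx//; lra.
  have w1 : 0 < 1 + w by lra.
  rewrite -[leLHS]mul1r ler_pdivrMr//; have := exprn_ge0 3 w0; nra.
have w4 : w ^+ 2 = z ^+ 4 / 4 by rewrite /w; field.
have z4 : 0 <= z ^+ 4 by rewrite exprn_ge0.
move: cosz; rewrite -/w => /andP[c1 c2]; rewrite ler_norml; lra.
Qed.

Lemma expr_dist_le (a b : R) n : `|a| <= 1 -> `|b| <= 1 ->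
  `|a ^+ n - b ^+ n| <= n%:R * `|a - b|.
Proof.
move=> a1 b1; elim: n => [|n ih]; first by rewrite !expr0 subrr normr0 mul0r.
rewrite (_ : a ^+ n.+1 - b ^+ n.+1 = a * (a ^+ n - b ^+ n) + (a - b) * b ^+ n); last first.
  by rewrite !exprS; ring.
rewrite (le_trans (ler_normD _ _))// -natr1 (mulrDl n%:R) mul1r lerD//.
  by rewrite normrM (le_trans _ ih)// ler_piMl.
by rewrite normrM normrX ler_piMr// exprn_ile1.
Qed.

(** With [z = y / sqrt n] the two bases differ by [O(z ^ 4) = O(n ^ -2)], hence
their [n]-th powers by [O(1 / n)]. *)
Lemma cvg_cosX_gauss (y : R) : 0 <= y ->
  (fun n => cos (y / Num.sqrt n.+1%:R) ^+ n.+1) @ \oo --> expR (- (y ^+ 2 / 2)).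
Proof.
move=> y0; apply: (@cvg_harmonic_bound _ _ (2 * y ^+ 4)) => n.
set m : R := n.+1%:R; have m0 : 0 < m by rewrite ltr0n.
have sm : 0 < Num.sqrt m by rewrite sqrtr_gt0.
have sm2 : Num.sqrt m ^+ 2 = m by rewrite sqr_sqrtr// ltW.
set z := y / Num.sqrt m; have z0 : 0 <= z by rewrite divr_ge0// ltW.
have -> : expR (- (y ^+ 2 / 2)) = expR (- (z ^+ 2 / 2)) ^+ n.+1.
  by rewrite -expRM_natl -/m /z expr_div_n sm2; congr expR; field; rewrite gt_eqF.
apply: le_trans (expr_dist_le _ _ _) _.
- exact: cos_max.
- by rewrite ger0_norm ?expR_ge0// expR_le1 oppr_le0 divr_ge0// sqr_ge0.
apply: (le_trans (ler_wpM2l (ler0n _ _) (cos_expR_dist z0))).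
rewrite -/m /z expr_div_n (_ : Num.sqrt m ^+ 4 = m ^+ 2); last first.
  by rewrite (exprM _ 2 2) sm2.
rewrite le_eqVlt; apply/orP; left; apply/eqP; field; by rewrite gt_eqF.
Qed.

Lemma bernoulli_le (y : R) K : 0 <= y <= 1 -> 1 - K%:R * y <= (1 - y) ^+ K.
Proof.
move=> /andP[y0 y1]; elim: K => [|K ih]; first by rewrite mul0r subr0 expr0.
rewrite exprS; apply: le_trans (_ : (1 - y) * (1 - K%:R * y) <= _).
  have : 0 <= K%:R * y ^+ 2 by rewrite mulr_ge0// sqr_ge0.
  rewrite -natr1; lra.
by rewrite ler_wpM2l//; lra.
Qed.

(** The powers sharpen the exponential into the indicator of a ray: the number
    of factors is chosen so that [K * expR (- m x)] tends to infinity on one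
    side of the threshold [b], the threshold included, and to [0] on the other. *)
Definition ray_power (b : R) (n : nat) : nat :=
  (Num.truncn (n.+1%:R * expR (n.+1%:R * b))).+1.

Lemma cvg_ray (b x : R) : 0 <= b -> 0 <= x ->
  (fun n => (1 - expR (- (n.+1%:R * x))) ^+ ray_power b n) @ \oo -->
  (\1_(`]b, +oo[%classic) x : R).
Proof.
move=> b0 x0.
have Kb n : n.+1%:R * expR (n.+1%:R * b) <= (ray_power b n)%:R <=
    n.+1%:R * expR (n.+1%:R * b) + 1.
  set v := n.+1%:R * _; have v0 : 0 <= v by rewrite mulr_ge0// expR_ge0.
  have /andP[h1 h2] := truncn_itv v0.
  by rewrite /ray_power -/v -natr1; apply/andP; split; lra.
have y01 n : 0 <= expR (- (n.+1%:R * x)) <= 1.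
  by rewrite expR_ge0 expR_le1 oppr_le0 mulr_ge0.
rewrite indicE; case: (boolP (x \in _)) => xb.
  have {}xb : b < x by move: xb; rewrite inE/= in_itv/= andbT.
  have -> : true%:R = 1 :> R by [].
  set e := x - b; have e0 : 0 < e by rewrite subr_gt0.
  have xgt0 : 0 < x by lra.
  apply: (@cvg_harmonic_bound _ _ (2 / e ^+ 2 + x^-1)) => n.
  have := bernoulli_le (ray_power b n) (y01 n).
  have p1 : (1 - expR (- (n.+1%:R * x))) ^+ ray_power b n <= 1.
    by rewrite exprn_ile1//; have := y01 n => /andP[]; lra.
  rewrite ler0_norm; last lra.
  move=> bern; rewrite opprB.
  apply: le_trans (_ : (ray_power b n)%:R * expR (- (n.+1%:R * x)) <= _); first lra.
  set m : R := n.+1%:R; have m0 : 0 < m by rewrite ltr0n.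
  apply: le_trans (_ : (m * expR (m * b) + 1) * expR (- (m * x)) <= _).
    by rewrite ler_wpM2r ?expR_ge0//; have /andP[] := Kb n.
  rewrite mulrDl mul1r -mulrA -expRD mulrDl lerD//.
    have -> : m * b - m * x = - (m * e) by rewrite /e; ring.
    rewrite expRN ler_pdivrMr ?expR_gt0//.
    have := @expR_ge1Dxn _ (m * e) 1 (mulr_ge0 (ltW m0) (ltW e0)).
    move=> h; apply: le_trans (_ : 2 / e ^+ 2 / m * ((m * e) ^+ 2 / 2) <= _).
      by rewrite le_eqVlt; apply/orP; left; apply/eqP; field; rewrite !gt_eqF.
    rewrite ler_wpM2l//; last by rewrite (_ : 2`! = 2)%N// in h; lra.
    by rewrite !divr_ge0// ?sqr_ge0// ltW.
  rewrite expRN -invfM lef_pV2 ?posrE ?expR_gt0 ?mulr_gt0//.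
  by have := expR_ge1Dx (m * x); rewrite mulrC; lra.
have -> : false%:R = 0 :> R by [].
have {}xb : x <= b.
  by move: xb; rewrite notin_setE /= in_itv/= andbT => /negP; rewrite -leNgt.
apply: (@cvg_harmonic_bound _ _ 1) => n.
set m : R := n.+1%:R; have m0 : 0 < m by rewrite ltr0n.
have /andP[y0 y1] := y01 n; rewrite -/m in y0 y1 *.
set y := expR (- (m * x)) in y0 y1 *.
rewrite subr0 ger0_norm; last by rewrite exprn_ge0//; lra.
apply: le_trans (_ : expR (- y) ^+ ray_power b n <= _).
  by rewrite lerXn2r ?nnegrE ?expR_ge0//; [lra|have := expR_ge1Dx (- y); lra].
rewrite -expRM_natl mulrN expRN mul1r lef_pV2 ?posrE ?expR_gt0//.
apply: le_trans (expR_ge1Dx _).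
apply: le_trans (_ : (ray_power b n)%:R * y <= _); last lra.
apply: le_trans (_ : m * expR (m * b) * y <= _); last first.
  by rewrite ler_wpM2r//; have /andP[] := Kb n.
rewrite /y -mulrA -expRD -[leLHS]mulr1 (ler_pM2l m0) -mulrBr.
by rewrite -[leLHS]expR0 ler_expR mulr_ge0 ?subr_ge0// ltW.
Qed.

End elementary_bounds.

(** * Half-line laws with equal cosine transforms *)

Section determinacy.
Context {R : realType}.
Variables (Q mu : probability R R).
Hypothesis Q_ge0 : {ae Q, forall x : R, 0 <= x}.
Hypothesis mu_ge0 : {ae mu, forall x : R, 0 <= x}.
Hypothesis same_cos : forall t, agree Q mu (cosq t).

Lemma agree_cosqX s t n : agree Q mu (fun x => cosq s x * cosq t x ^+ n).
Proof.
elim: n s => [|n ih] s.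
  by have := same_cos s; congr agree; apply/funext => x; rewrite expr0 mulr1.
have := agreeZ 2^-1 (agreeD (ih (s + t)) (ih (s - t))).
by congr agree; apply/funext => x; rewrite -mulrDl cosqDB exprS; field.
Qed.

(** [cosq (t / sqrt n) ^ n] is an average of functions [cosq s], and it converges
boundedly to a Gaussian in [sqrt x]. *)
Lemma agree_gauss t : 0 <= t -> agree Q mu (fun x => expR (- (t ^+ 2 * x / 2))).
Proof.
move=> t0.
pose F n x : R := cosq (t / Num.sqrt n.+1%:R) x ^+ n.+1.
have cvgF (x : R) : 0 <= x -> F ^~ x @ \oo --> expR (- (t ^+ 2 * x / 2)).
  move=> x0; rewrite -(sqr_sqrtr x0) -exprMn /F.
  have := cvg_cosX_gauss (mulr_ge0 t0 (sqrtr_ge0 x)).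
  rewrite (_ : (fun n => cos _ ^+ _) =
     (fun n => cosq (t / Num.sqrt n.+1%:R) (Num.sqrt x ^+ 2) ^+ n.+1))//.
  by apply/funext => n; rewrite sqr_sqrtr// mulrAC cosq_ge0.
have F1 (x : R) : 0 <= x -> forall n, `|F n x| <= 1.
  by move=> x0 n; rewrite /F normrX exprn_ile1// norm_cosq_le1.
have [Q1 mu1 _] := agree_cst Q mu 1.
apply: (agree_lim (F := F) (g := fun=> 1)) => //.
- move=> n; have := agree_cosqX 0 (t / Num.sqrt n.+1%:R) n.+1.
  by congr agree; apply/funext => x; rewrite cosq0 mul1r.
- apply: measurableT_comp; first exact: measurable_expR.
  apply: measurableT_comp; first exact: oppr_measurable.
  by apply: measurable_funM => //; apply: measurable_funM.
- by move: Q_ge0; apply: filterS.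
- by move: mu_ge0; apply: filterS.
- by move: Q_ge0; apply: filterS.
- by move: mu_ge0; apply: filterS.
Qed.

Lemma agree_expR a : 0 <= a -> agree Q mu (fun x => expR (- (a * x))).
Proof.
move=> a0; have := agree_gauss (sqrtr_ge0 (2 * a)).
congr agree; apply/funext => x; rewrite sqr_sqrtr ?mulr_ge0//; congr (expR (- _)).
by field.
Qed.

Lemma agree_expR_power a b n : 0 <= a -> 0 <= b ->
  agree Q mu (fun x => expR (- (a * x)) * (1 - expR (- (b * x))) ^+ n).
Proof.
move=> a0 b0; elim: n a a0 => [|n ih] a a0.
  by have := agree_expR a0; congr agree; apply/funext => x; rewrite expr0 mulr1.
have := agreeB (ih a a0) (ih (a + b) (addr_ge0 a0 b0)).
congr agree; apply/funext => x; rewrite exprS mulrDl opprD expRD; ring.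
Qed.

Lemma agree_ray b : 0 <= b -> agree Q mu (\1_(`]b, +oo[%classic) : R -> R).
Proof.
move=> b0.
pose F n x : R := (1 - expR (- (n.+1%:R * x))) ^+ ray_power b n.
have cF (x : R) : 0 <= x -> F ^~ x @ \oo --> (\1_(`]b, +oo[%classic) x : R).
  by move=> x0; exact: cvg_ray.
have F1 (x : R) : 0 <= x -> forall n, `|F n x| <= 1.
  move=> x0 n; rewrite /F normrX exprn_ile1// ger0_norm ?subr_ge0 ?expR_le1.
    by rewrite gerBl expR_ge0.
  by rewrite oppr_le0 mulr_ge0.
have [Q1 mu1 _] := agree_cst Q mu 1.
apply: (agree_lim (F := F) (g := fun=> 1)) => //.
- move=> n; have := agree_expR_power (ray_power b n) (lexx 0) (ler0n _ n.+1).
  by congr agree; apply/funext => x; rewrite mul0r oppr0 expR0 mul1r.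
- by move: Q_ge0; apply: filterS.
- by move: mu_ge0; apply: filterS.
- by move: Q_ge0; apply: filterS.
- by move: mu_ge0; apply: filterS.
Qed.

(** The rays [b < x] form a pi-system generating the Borel sets; those with
[b < 0] have full mass under both laws. *)
Lemma eq_of_cosq (A : set R) : measurable A -> Q A = mu A.
Proof.
have ray b : Q `]b, +oo[%classic = mu `]b, +oo[%classic.
  have mb : measurable (`]b, +oo[%classic : set R) by exact: measurable_itv.
  have [b0|b0] := leP 0 b.
    have [_ _] := agree_ray b0.
    rewrite /Rintegral !integral_indic// !setIT => /(congr1 (@EFin R)).
    by rewrite !fineK// fin_num_measure.
  have one (P : probability R R) : {ae P, forall x : R, 0 <= x} ->
      P `]b, +oo[%classic = 1%E.
    move=> P0; pose B : set R := `]b, +oo[%classic; rewrite -/B.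
    have PB0 : P (~` B) = 0%E.
      apply/negligibleP; first exact: measurableC.
      apply: negligibleS P0 => x /= xb; apply/negP; rewrite -ltNge.
      move/negP: xb; rewrite in_itv/= andbT -leNgt => xb; exact: le_lt_trans b0.
    have := probability_setC P (measurableC mb).
    by rewrite setCK PB0 sube0.
  by rewrite !one.
move=> mA.
apply: (measure_unique (@RGenOInfty.G R)
  (fun n : nat => `](- (n%:R : R)), +oo[%classic)) => //.
- exact: RGenOInfty.measurableE.
- move=> _ _ [x ->] [y ->]; exists (Num.max x y).
  by apply/seteqP; split => z /=; rewrite !in_itv/= !andbT gt_max => /andP.
- by move=> n; eexists.
- apply/seteqP; split => // x _; exists (Num.bound `|x|) => //=.
  rewrite in_itv/= andbT ltrNl; apply: le_lt_trans (archi_boundP (normr_ge0 x)).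
  by rewrite -normrN ler_norm.
- by move=> _ [x ->]; exact: ray.
- by move=> k; rewrite -ge0_fin_numE//; apply: fin_num_measure; exact: measurable_itv.
Qed.

End determinacy.

(** Hardy's condition on a law carried by the half-line: moments growing like
    [(2 k)!] determine the law, even among all laws on the whole line. *)
Theorem half_line_determinate {R : realType} (mu : probability R R) (D : R) :
  {ae mu, forall x : R, 0 <= x} -> 0 <= D ->
  (forall k : nat,
    (\int[mu]_x (`|x| ^+ k)%:E <= (D ^+ k * (k.*2)`!%:R)%:E)%E) ->
  forall Q : probability R R,
  (forall k : nat, agree Q mu (fun x => x ^+ k)) ->
  forall A : set R, measurable A -> Q A = mu A.
Proof.
move=> mu0 D0 mom Q same A mA.
have same_cos t : agree Q mu (cosq t).
  have := agree_cosqT mu0 D0 mom same t 0%N.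
  by congr agree; apply/funext => x; rewrite expr0 mul1r.
exact: (eq_of_cosq (ae_ge0_of_agree mu0 D0 mom same) mu0 same_cos mA).
Qed.

(** * Powers against stretched exponentials *)

Section power_vs_exponential.
Context {R : realType}.
Implicit Types (x y z a b p s : R).
Local Notation leb := (@lebesgue_measure R).

(** The power [p / b] of the inequality [u <= exp u], at
[u = a * b * x ^ b / p]. *)
Lemma powR_le_expR p a b x : 0 < p -> 0 < a -> 0 < b -> 0 <= x ->
  x `^ p <= (p / (a * b)) `^ (p / b) * expR (a * x `^ b).
Proof.
move=> p0 a0 b0 x0.
have c0 : 0 < p / (a * b) by rewrite divr_gt0// mulr_gt0.
set c := p / (a * b) in c0 *; set y := x `^ b.
have y0 : 0 <= y by exact: powR_ge0.
have -> : x `^ p = y `^ (p / b) by rewrite -powRrM mulrC divfK// gt_eqF.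
have -> : y = c * (y / c) by rewrite mulrC divfK// gt_eqF.
have z0 : 0 <= y / c by rewrite divr_ge0// ltW.
rewrite (powRM _ (ltW c0) z0) ler_wpM2l ?powR_ge0//.
have -> : a * (c * (y / c)) = (y / c) * (p / b).
  by rewrite /c; field; rewrite !gt_eqF.
rewrite expRM ge0_ler_powR ?nnegrE ?expR_ge0//; first by rewrite divr_ge0// ltW.
by have := expR_ge1Dx (y / c); lra.
Qed.

Lemma powR_bounded_expR p a b : 0 <= p -> 0 < a -> 0 < b ->
  exists2 K : R, 0 <= K & forall x, 0 <= x -> x `^ p <= K * expR (a * x `^ b).
Proof.
move=> p0 a0 b0; have [p1|p1] := ltP 0 p.
  exists ((p / (a * b)) `^ (p / b)) => [|x x0]; first exact: powR_ge0.
  exact: powR_le_expR.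
exists 1 => // x x0; have -> : p = 0 by lra.
rewrite powRr0 mul1r -[leLHS]expR0 ler_expR mulr_ge0 ?powR_ge0//; lra.
Qed.

Lemma measurable_powR_expR s a b (D : set R) :
  measurable_fun D (fun x => x `^ s * expR (- (a * x `^ b))).
Proof.
apply: (measurable_funS measurableT) => //.
apply: measurable_funM; first exact: measurable_powR.
apply: measurableT_comp => //; apply: measurableT_comp => //.
by apply: measurable_funM => //; exact: measurable_powR.
Qed.

Lemma integrable_inv_sqr :
  leb.-integrable `]0, +oo[ (EFin \o (fun x : R => (1 + x ^+ 2)^-1)).
Proof.
suff I : leb.-integrable `[0, +oo[ (EFin \o (fun x : R => (1 + x ^+ 2)^-1)).
  apply: integrableS I => //.
  by move=> x /=; rewrite !in_itv/= !andbT => /ltW.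
apply: integrable_lt_pinfty => //.
- apply: (measurable_funS measurableT) => //.
  apply: continuous_measurable_fun; exact: continuous_oneDsqrV.
- by move=> x _; rewrite invr_ge0 addr_ge0// sqr_ge0.
- by have := @integral0y_oneDsqr R; rewrite /oneDsqr => ->; rewrite ltry.
Qed.

Lemma integrable_powR_expR s a b : 0 <= s -> 0 < a -> 0 < b ->
  leb.-integrable `]0, +oo[ (EFin \o (fun x => x `^ s * expR (- (a * x `^ b)))).
Proof.
move=> s0 a0 b0.
have [K1 K10 h1] := powR_bounded_expR s0 a0 b0.
have [K2 K20 h2] := powR_bounded_expR (addr_ge0 s0 (ler0n R 2)) a0 b0.
have I : leb.-integrable `]0, +oo[ (EFin \o (fun x : R => (K1 + K2) * (1 + x ^+ 2)^-1)).
  by apply: integrable_EFinZ => //; exact: integrable_inv_sqr.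
apply: integrable_le I => //.
- exact: measurable_powR_expR.
- move=> x /=; rewrite in_itv/= andbT => x0.
  rewrite ger0_norm ?mulr_ge0 ?powR_ge0 ?expR_ge0//.
  have q0 : 0 < 1 + x ^+ 2 by rewrite ltr_pwDl// sqr_ge0.
  rewrite ler_pdivlMr// mulrDr mulr1 mulrAC -(powR_mulrn 2 (ltW x0)).
  rewrite -powRD; last by apply/implyP => _; rewrite (gt_eqF x0).
  by rewrite expRN lerD// ler_pdivrMr ?expR_gt0// ?h1 ?h2// ltW.
Qed.

End power_vs_exponential.

(** * A function all of whose moments vanish *)

Section vanishing_moments.
Context {R : realType}.
Implicit Types (x y t : R).
Local Notation leb := (@lebesgue_measure R).
Variables (l d : R) (q : nat).
Hypotheses (l_gt0 : 0 < l) (d_gt0 : 0 < d).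
Let p : R := q.+1%:R / d.

(** Imaginary part of [x ^ q * exp (- l * x ^ d * e ^ (i t)) * e ^ (i p t)],
    up to sign: the integrand of a Gamma integral along the ray of argument
    [t], whose value does not depend on [t]. *)
Definition ray_integrand t x : R :=
  x ^+ q * (expR (- (l * cos t * x `^ d)) * sin (l * sin t * x `^ d - p * t)).

(** The variation of the ray integrand with the angle is an exact derivative in
[x], up to the factor [- d]; this is the Cauchy-Riemann equation behind the
rotation of the contour. *)
Definition ray_primitive t x : R :=
  x ^+ q.+1 * (expR (- (l * cos t * x `^ d)) * cos (l * sin t * x `^ d - p * t)).

Definition ray_dt t x : R :=
  x ^+ q * (expR (- (l * cos t * x `^ d)) *
    (l * sin t * x `^ d * sin (l * sin t * x `^ d - p * t) +
     (l * cos t * x `^ d - p) * cos (l * sin t * x `^ d - p * t))).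

Lemma is_derive_ray_integrand t x : is_derive t 1 (ray_integrand ^~ x) (ray_dt t x).
Proof.
rewrite /ray_integrand.
have de : is_derive t 1 (fun t : R => expR (- (l * cos t * x `^ d)))
   (expR (- (l * cos t * x `^ d)) * (l * sin t * x `^ d)).
  apply: (@is_derive1_comp _ expR (fun t => - (l * cos t * x `^ d))).
  by apply: is_derive_eq; rewrite /GRing.scale/=; ring.
have ds : is_derive t 1 (fun t : R => sin (l * sin t * x `^ d - p * t))
   (cos (l * sin t * x `^ d - p * t) * (l * cos t * x `^ d - p)).
  apply: (@is_derive1_comp _ sin (fun t => l * sin t * x `^ d - p * t)).
  by apply: is_derive_eq; rewrite /GRing.scale/=; ring.
by apply: is_derive_eq; rewrite /ray_dt /GRing.scale/=; ring.
Qed.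

Lemma is_derive_ray_primitive t x : 0 < x ->
  is_derive x 1 (ray_primitive t) (- d * ray_dt t x).
Proof.
move=> x0; rewrite /ray_primitive.
have dp := is_derive1_powR d x0.
have de : is_derive x 1 (fun x : R => expR (- (l * cos t * x `^ d)))
   (expR (- (l * cos t * x `^ d)) * (- (l * cos t * (d * x `^ (d - 1))))).
  apply: (@is_derive1_comp _ expR (fun x => - (l * cos t * x `^ d))).
have dc : is_derive x 1 (fun x : R => cos (l * sin t * x `^ d - p * t))
   (- sin (l * sin t * x `^ d - p * t) * (l * sin t * (d * x `^ (d - 1)))).
  apply: (@is_derive1_comp _ cos (fun x => l * sin t * x `^ d - p * t)).
  move: (l * sin t) (p * t) => a k.
  have da : is_derive x 1 (fun x : R => a * x `^ d) (a * (d * x `^ (d - 1))).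
    by apply: is_derive_eq; rewrite /GRing.scale/=; ring.
  rewrite -[X in is_derive _ _ _ X]subr0; apply: is_deriveB.
have dx : is_derive x 1 (fun x : R => x ^+ q.+1) (q.+1%:R * x ^+ q).
  rewrite (_ : (fun x : R => x ^+ q.+1) = id ^+ q.+1); last by rewrite exprfctE.
  by apply: is_derive_eq; rewrite /GRing.scale/= mulr1.
apply: is_derive_eq; rewrite /ray_dt /GRing.scale/=.
have xd : x `^ d = x * x `^ (d - 1) by rewrite mulr_powRB1// ltW.
have pd : p * d = q.+1%:R by rewrite /p divfK// gt_eqF.
rewrite exprS -pd; move: (expR _) (cos (_ - _)) (sin (_ - _)) => E C S.
rewrite xd; ring.
Qed.

Lemma continuous_ray_dt t x : 0 < x -> {for x, continuous (ray_dt t)}.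
Proof.
move=> x0; apply: differentiable_continuous; apply/derivable1_diffP.
have dp := is_derive1_powR d x0.
have de : is_derive x 1 (fun x : R => expR (- (l * cos t * x `^ d)))
   (expR (- (l * cos t * x `^ d)) * (- (l * cos t * (d * x `^ (d - 1))))).
  apply: (@is_derive1_comp _ expR (fun x => - (l * cos t * x `^ d))).
have dc : is_derive x 1 (fun x : R => cos (l * sin t * x `^ d - p * t))
   (- sin (l * sin t * x `^ d - p * t) * (l * sin t * (d * x `^ (d - 1)))).
  apply: (@is_derive1_comp _ cos (fun x => l * sin t * x `^ d - p * t)).
  by apply: is_derive_eq; rewrite /GRing.scale/=; ring.
have ds : is_derive x 1 (fun x : R => sin (l * sin t * x `^ d - p * t))
   (cos (l * sin t * x `^ d - p * t) * (l * sin t * (d * x `^ (d - 1)))).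
  apply: (@is_derive1_comp _ sin (fun x => l * sin t * x `^ d - p * t)).
  by apply: is_derive_eq; rewrite /GRing.scale/=; ring.
have dx : is_derive x 1 (fun x : R => x ^+ q) (q%:R * x ^+ q.-1).
  rewrite (_ : (fun x : R => x ^+ q) = id ^+ q); last by rewrite exprfctE.
  by apply: is_derive_eq; rewrite /GRing.scale/= mulr1.
apply: ex_derive.
Qed.

Section rotation.
Variable k : R.
Hypothesis k_gt0 : 0 < k.

(* dominates the angular derivative for all angles with [k <= l * cos t] *)
Let G x : R := 2 * l * (x `^ (q%:R + d) * expR (- (k * x `^ d))) +
  p * (x `^ q%:R * expR (- (k * x `^ d))).

Let p_ge0 : 0 <= p. Proof. by rewrite divr_ge0// ltW. Qed.

Let G_ge0 x : 0 <= G x.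
Proof.
have e0 := expR_ge0 (- (k * x `^ d)); have l0 := ltW l_gt0.
have h s := powR_ge0 x s.
by apply: addr_ge0; apply: mulr_ge0 => //; apply: mulr_ge0. Qed.

Let integrable_G : leb.-integrable `]0, +oo[ (EFin \o G).
Proof.
apply: integrable_EFinD => //; apply: integrable_EFinZ => //; apply: integrable_powR_expR => //.
by rewrite addr_ge0// ltW.
Qed.

Let expR_cos_le t x : k <= l * cos t -> expR (- (l * cos t * x `^ d)) <= expR (- (k * x `^ d)).
Proof. by move=> kt; rewrite ler_expR lerN2 ler_wpM2r// powR_ge0. Qed.

Let norm_ray_dt t x : k <= l * cos t -> 0 < x -> `|ray_dt t x| <= G x.
Proof.
move=> kt x0; have y0 : 0 <= x `^ d by exact: powR_ge0.
have xq0 : 0 <= x ^+ q by rewrite exprn_ge0// ltW.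
have -> : G x = x ^+ q * (expR (- (k * x `^ d)) * (2 * l * x `^ d + p)).
  rewrite /G powRD; last by apply/implyP => _; rewrite (gt_eqF x0).
  rewrite powR_mulrn ?ltW//; ring.
rewrite /ray_dt normrM (ger0_norm xq0) ler_wpM2l// normrM ger0_norm ?expR_ge0//.
apply: ler_pM => //; first exact: expR_cos_le.
apply: (le_trans (ler_normD _ _)); rewrite !normrM (ger0_norm y0) (gtr0_norm l_gt0).
have ss := sin_max t; have cc := cos_max t.
have s1 : l * `|sin t| * x `^ d * `|sin (l * sin t * x `^ d - p * t)| <= l * x `^ d.
  rewrite -mulrA -mulrA (ler_pM2l l_gt0).
  rewrite mulrCA -[leRHS]mulr1 ler_wpM2l//.
  by rewrite -[leRHS]mulr1 ler_pM// sin_max.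
have c1 : `|l * cos t * x `^ d - p| * `|cos (l * sin t * x `^ d - p * t)| <= l * x `^ d + p.
  rewrite -[leRHS]mulr1 ler_pM ?cos_max//.
  apply: (le_trans (ler_normB _ _)); rewrite (ger0_norm p_ge0) lerD2r.
  rewrite !normrM (ger0_norm y0) (gtr0_norm l_gt0) ler_wpM2r//.
  by rewrite -[leRHS]mulr1 (ler_pM2l l_gt0).
lra.
Qed.

Let measurable_ray_dt t : measurable_fun (`]0, +oo[%classic : set R) (ray_dt t).
Proof.
apply: open_continuous_measurable_fun => //.
move=> x; rewrite inE/= in_itv/= andbT; exact: continuous_ray_dt.
Qed.

Let integrable_ray_dt t : k <= l * cos t ->
  leb.-integrable `]0, +oo[ (EFin \o ray_dt t).
Proof.
move=> kt; apply: integrable_le integrable_G => //; first exact: measurable_ray_dt.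
by move=> x /=; rewrite in_itv/= andbT; exact: norm_ray_dt.
Qed.

Lemma integrable_ray_integrand t : k <= l * cos t ->
  leb.-integrable `]0, +oo[ (EFin \o ray_integrand t).
Proof.
move=> kt.
have I : leb.-integrable `]0, +oo[ (EFin \o (fun x : R => x `^ q%:R * expR (- (k * x `^ d)))).
  exact: integrable_powR_expR.
apply: integrable_le I => //.
  apply: (measurable_funS measurableT) => //.
  apply: measurable_funM; first exact: measurable_funX.
  have mp a : measurable_fun setT (fun x : R => a * x `^ d).
    by apply: measurable_funM => //; exact: measurable_powR.
  apply: measurable_funM; apply: measurableT_comp => //.
    by apply: measurableT_comp => //; exact: mp.
    exact: continuous_measurable_fun (@continuous_sin R).
  by apply: measurable_funB => //; exact: mp.
move=> x /=; rewrite in_itv/= andbT => x0.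
rewrite (powR_mulrn _ (ltW x0)) /ray_integrand normrM ger0_norm; last by rewrite exprn_ge0// ltW.
rewrite (ler_wpM2l (exprn_ge0 _ (ltW x0)))// normrM ger0_norm ?expR_ge0//.
by rewrite -[leRHS]mulr1 ler_pM ?expR_ge0// ?sin_max// expR_cos_le.
Qed.

Let norm_ray_primitive t x : k <= l * cos t -> 0 < x ->
  `|ray_primitive t x| <= x ^+ q.+1 * expR (- (k * x `^ d)).
Proof.
move=> kt x0; rewrite /ray_primitive normrM ger0_norm; last by rewrite exprn_ge0// ltW.
rewrite (ler_wpM2l (exprn_ge0 _ (ltW x0)))// normrM ger0_norm ?expR_ge0//.
by rewrite -[leRHS]mulr1 ler_pM ?expR_ge0// ?cos_max// expR_cos_le.
Qed.

(** The primitive vanishes at [0] and at infinity; the integral is exhausted by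
the intervals from [1 / (n + 2)] to [n + 2]. *)
Lemma Rintegral_ray_dt t : k <= l * cos t ->
  \int[leb]_(x in `]0, +oo[) ray_dt t x = 0.
Proof.
move=> kt.
have [K K0 hK] := powR_bounded_expR (ler0n R q.+2) k_gt0 d_gt0.
pose a n : R := n.+2%:R^-1; pose b n : R := n.+2%:R.
have ab n : 0 < a n /\ a n < b n.
  rewrite /a /b; split; first by rewrite invr_gt0.
  by rewrite invf_plt ?posrE// (le_lt_trans _ (_ : 1 < _))// ?ltr1n// invf_le1// ler1n.
have In n : \int[leb]_(x in `[a n, b n]) ray_dt t x =
    - d^-1 * (ray_primitive t (b n) - ray_primitive t (a n)).
  have [a0 anb] := ab n.
  rewrite /Rintegral (@continuous_FTC2 _ _ (fun x => - d^-1 * ray_primitive t x))//.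
  - by rewrite -EFinB/= mulrBr.
  - apply: continuous_in_subspaceT => x; rewrite inE/= in_itv/= => /andP[ax _].
    exact: continuous_ray_dt (lt_le_trans a0 ax).
  - have dF x : 0 < x -> derivable (fun x => - d^-1 * ray_primitive t x) x 1.
      by move=> x0; have dW := is_derive_ray_primitive t x0; apply: ex_derive.
    have cF x : 0 < x -> {for x, continuous (fun x => - d^-1 * ray_primitive t x)}.
      by move=> /dF dFx; apply: differentiable_continuous; apply/derivable1_diffP.
    split.
    + by move=> x; rewrite in_itv/= => /andP[ax _]; exact/dF/(lt_trans a0 ax).
    + by apply: cvg_at_right_filter; exact: cF.
    + by apply: cvg_at_left_filter; exact/cF/(lt_trans a0).
  - move=> x; rewrite in_itv/= => /andP[ax _].
    have dW := is_derive_ray_primitive t (lt_trans a0 ax).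
    rewrite derive1E.
    have [_ ->] : is_derive x 1 (fun x => - d^-1 * ray_primitive t x) (ray_dt t x).
      by apply: is_derive_eq; rewrite /GRing.scale/=; field; rewrite gt_eqF.
    by [].
have cvg0 : (fun n => \int[leb]_(x in `[a n, b n]) ray_dt t x) @ \oo --> (0 : R).
  apply: (@cvg_harmonic_bound _ _ _ (d^-1 * (K + 1))) => n.
  have [a0 anb] := ab n; have b0 := lt_trans a0 anb.
  rewrite subr0 In normrM normrN (gtr0_norm (_ : 0 < d^-1)) ?invr_gt0//.
  rewrite -mulrA ler_wpM2l//; first by rewrite invr_ge0 ltW.
  apply: (le_trans (ler_normB _ _)); rewrite mulrDl lerD//.
    apply: (le_trans (norm_ray_primitive kt b0)).
    rewrite expRN ler_pdivrMr ?expR_gt0// mulrAC ler_pdivlMr//.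
    apply: le_trans (hK _ (ltW b0)).
    by rewrite (powR_mulrn _ (ltW b0)) [leRHS]exprSr (ler_wpM2l (exprn_ge0 _ (ltW b0)))// ler_nat.
  apply: (le_trans (norm_ray_primitive kt a0)).
  apply: (@le_trans _ _ (a n ^+ q.+1)).
    rewrite (ler_piMr (exprn_ge0 _ (ltW a0)))// expR_le1 oppr_le0.
    by rewrite mulr_ge0 ?powR_ge0//; exact: ltW.
  rewrite exprS mul1r -[leRHS]mulr1 (ler_pM (ltW a0) (exprn_ge0 _ (ltW a0)))//.
    by rewrite lef_pV2 ?posrE// ler_nat.
  by rewrite exprn_ile1 ?(ltW a0)// invf_le1// ler1n.
have cvgI : (fun n => \int[leb]_(x in `[a n, b n]) ray_dt t x) @ \oo -->
    (\int[leb]_(x in `]0, +oo[) ray_dt t x).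
  have abD n : `[a n, b n] `<=` `]0%R, +oo[.
    move=> x /=; rewrite !in_itv/= andbT => /andP[ax _].
    by have [a0 _] := ab n; exact: lt_le_trans ax.
  have E n : \int[leb]_(x in `[a n, b n]) ray_dt t x =
      \int[leb]_(x in `]0, +oo[) ((ray_dt t) \_ `[a n, b n]) x.
    by rewrite -Rintegral_mkcondl setIidl.
  under eq_fun do rewrite E.
  have [] := @dominated_convergence _ _ _ leb `]0, +oo[%classic _
    (fun n => EFin \o ((ray_dt t) \_ `[a n, b n])) (EFin \o ray_dt t) (EFin \o G) _ _ _ integrable_G _.
  - exact: measurable_itv.
  - move=> n; apply/measurable_EFinP/measurable_restrict => //.
    by apply: measurable_funS (measurable_ray_dt t) => //; exact: subIsetl.
  - by apply/measurable_EFinP; exact: measurable_ray_dt.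
  - apply: aeW => x /=; rewrite in_itv/= andbT => x0.
    apply: cvg_near_cst; near=> n.
    rewrite patchE mem_set//= in_itv/=; apply/andP; split.
      rewrite /a -[leRHS]invrK lef_pV2 ?posrE ?invr_gt0//.
      near: n; exists (Num.bound x^-1) => // m /= hm.
      apply/ltW/(lt_le_trans (archi_boundP _)); first by rewrite invr_ge0 ltW.
      by rewrite ler_nat (leq_trans hm)// -addn2 leq_addr.
    near: n; exists (Num.bound x) => // m /= hm.
    apply/ltW/(lt_le_trans (archi_boundP (ltW x0))).
    by rewrite ler_nat (leq_trans hm)// -addn2 leq_addr.
  - apply: aeW => x n /=; rewrite in_itv/= andbT => x0.
    rewrite lee_fin patchE; case: ifP => _; first exact: norm_ray_dt.
    by rewrite normr0.
  - move=> _ _; rewrite EFin_Rintegral//; last exact: integrable_ray_dt.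
    exact: fine_cvg.
by rewrite -(cvg_lim _ cvgI)// (cvg_lim _ cvg0).
Unshelve. all: by end_near. Qed.

(** The integral is constant in the angle, by differentiation under the integral
sign, and zero at the angle [0]. The larger angle [t'] leaves room for a two-sided
neighbourhood on which one function dominates. *)
Lemma Rintegral_ray_integrand_lt t t' : 0 < t -> t < t' -> t' < pi / 2 ->
  k = l * cos t' -> \int[leb]_(x in `]0, +oo[) ray_integrand t x = 0.
Proof.
move=> t0 tt' t'pi kE.
have kcos s : s \in `]- t', t'[ -> k <= l * cos s.
  rewrite in_itv/= => st'; rewrite kE (ler_pM2l l_gt0) -(cos_norm s).
  have st : `|s| < t' by rewrite ltr_norml.
  have t'0 : 0 < t' by apply: lt_trans tt'.
  have pi0 := pi_gt0 R.
  have sI : `|s| \in `[0, pi] by rewrite in_itv/= normr_ge0/=; lra.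
  have tI : t' \in `[0, pi] by rewrite in_itv/=; apply/andP; split; lra.
  by apply: ltW; rewrite (ltr_cos sI tI).
pose J s := \int[leb]_(x in `]0, +oo[) ray_integrand s x.
have dJ s : s \in `]- t', t'[ -> is_derive s 1 J 0.
  move=> sI.
  have intf r : `]- t', t'[%classic r ->
      leb.-integrable `]0, +oo[ (EFin \o ray_integrand r).
    by move=> /kcos; exact: integrable_ray_integrand.
  have derf r x : `]- t', t'[%classic r -> `]0, +oo[%classic x ->
      derivable (ray_integrand ^~ x) r 1.
    by move=> _ _; have dr := is_derive_ray_integrand r x; apply: ex_derive.
  have dE r x : partial1of2 ray_integrand r x = ray_dt r x.
    have dr := is_derive_ray_integrand r x.
    by rewrite partial1of2E derive_val.
  have Gub r x : `]- t', t'[%classic r -> `]0, +oo[%classic x ->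
      `|partial1of2 ray_integrand r x| <= G x.
    move=> /kcos kr; rewrite /= in_itv/= andbT => x0.
    by rewrite dE; exact: norm_ray_dt.
  have mD : measurable (`]0, +oo[%classic : set (measurableTypeR R)).
    exact: measurable_itv.
  apply: DeriveDef.
    exact: (derivable_under_integral mD sI intf derf G_ge0 integrable_G Gub).
  rewrite -derive1E.
  rewrite (differentiation_under_integral mD sI intf derf G_ge0 integrable_G Gub).
  rewrite -[RHS](Rintegral_ray_dt (kcos _ sI)).
  by apply: eq_Rintegral => x _; rewrite dE.
have xI x : 0 <= x <= t -> x \in `]- t', t'[.
  by move=> /andP[x0 xt]; rewrite in_itv/=; apply/andP; split; lra.
have dJt x : x \in `]0, t[ -> is_derive x 1 J ((fun=> 0) x).
  rewrite in_itv/= => /andP[x0 xt]; apply/dJ/xI.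
  by apply/andP; split; apply: ltW.
have cJ : {within `[0, t], continuous J}.
  apply: derivable_within_continuous => x; rewrite in_itv/= => /xI xJ.
  by have [] := dJ x xJ.
have [c _] := MVT_segment (ltW t0) dJt cJ.
rewrite mul0r => /eqP; rewrite subr_eq0 => /eqP; rewrite /J => ->.
transitivity (\int[leb]_(x in `]0, +oo[) (0 : R)).
  apply: eq_Rintegral => x _.
  by rewrite /ray_integrand sin0 !mulr0 mul0r subr0 sin0 !mulr0.
by rewrite /Rintegral integral0.
Qed.

End rotation.

Lemma Rintegral_ray_integrand t : 0 < t < pi / 2 ->
  \int[leb]_(x in `]0, +oo[) ray_integrand t x = 0.
Proof.
move=> /andP[t0 tpi]; pose t' := (t + pi / 2) / 2.
have h1 : t < t' by rewrite /t'; lra.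
have h2 : t' < pi / 2 by rewrite /t'; lra.
apply: (@Rintegral_ray_integrand_lt (l * cos t') _ t t') => //.
by rewrite mulr_gt0// cos_gt0_pihalf// h2 andbT; lra.
Qed.

End vanishing_moments.

Section stieltjes_function.
Context {R : realType}.
Variables (l d : R).
Hypotheses (l_gt0 : 0 < l) (d_gt0 : 0 < d) (d_lt : d < 2^-1).

Definition stieltjes_fun (x : R) : R :=
  expR (- (l * cos (pi * d) * x `^ d)) * sin (l * sin (pi * d) * x `^ d).

(** At the angle [pi * d] the rotated Gamma integrals of all orders
    [(q + 1) / d] become real at once, so that the imaginary part has vanishing
    moments; [d < 1 / 2] is what makes the rotation legitimate. *)
Lemma stieltjes_fun_moment (q : nat) :
  \int[@lebesgue_measure R]_(x in `]0, +oo[) (x ^+ q * stieltjes_fun x) = 0.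
Proof.
have h : 0 < pi * d < pi / 2.
  by rewrite mulr_gt0 ?pi_gt0//= ltr_pM2l ?pi_gt0.
have := @Rintegral_ray_integrand _ l d q l_gt0 d_gt0 _ h.
set I := (X in X = 0 -> _) => I0.
transitivity ((-1) ^+ q.+1 * I); last by rewrite I0 mulr0.
have E x : x ^+ q * stieltjes_fun x = (-1) ^+ q.+1 * ray_integrand l d q (pi * d) x.
  rewrite /stieltjes_fun /ray_integrand.
  have -> : q.+1%:R / d * (pi * d) = pi *+ q.+1 :> R.
    by rewrite -mulr_natl; field; rewrite gt_eqF.
  set y := l * _ * _.
  have -> : sin (l * sin (pi * d) * x `^ d) =
      (-1) ^+ q.+1 * sin (l * sin (pi * d) * x `^ d - pi *+ q.+1).
    by rewrite -(alternatingn (@sinDpi R)) subrK.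
  ring.
under eq_Rintegral do rewrite E.
rewrite RintegralZl//.
have c0 : 0 < cos (pi * d).
  by have /andP[h1 h2] := h; apply: cos_gt0_pihalf; apply/andP; split; lra.
have k0 := mulr_gt0 l_gt0 c0.
exact: integrable_ray_integrand k0 _ (lexx _).
Qed.

End stieltjes_function.

(** * Products of independent random variables *)

Section joint_law.
Context d (T : measurableType d) (R : realType) (P : probability T R).

(** Normalizing by [P E] reduces the identity to the uniqueness of the product
measure. The event [E] carries the variables which do not take part in the
product. *)
Lemma joint_law_restricted (X Y : {RV P >-> R}) (E : set T) :
  measurable E ->
  (forall A B : set R, measurable A -> measurable B ->
    P (X @^-1` A `&` (Y @^-1` B `&` E)) =
    (P (X @^-1` A) * (P (Y @^-1` B) * P E))%E) ->
  forall C : set (R * R), measurable C ->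
  P ([set w | C (X w, Y w)] `&` E) =
  ((distribution P X \x distribution P Y) C * P E)%E.
Proof.
move=> mE indep C mC.
have mXY : measurable_fun setT (fun w => (X w, Y w)) by exact: measurable_fun_pair.
have [e0|e0] := eqVneq (P E) 0%E.
  rewrite e0 mule0; apply/eqP; rewrite -measure_le0 -e0 le_measure ?inE//.
  by apply: measurableI => //; rewrite -[X in measurable X]setTI; exact: mXY.
have PEfin : P E \is a fin_num by exact: fin_num_measure.
have e_gt0 : 0 < fine (P E) by rewrite fine_gt0// lt0e e0 measure_ge0/= ltey_eq PEfin.
have [m mE'] : exists m : {measure set (R * R) -> \bar R},
    forall C, m C = P ([set w | C (X w, Y w)] `&` E).
  unshelve refine (ex_intro _ (pushforward (mrestr P mE) (fun w => (X w, Y w))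
    : {measure set (R * R) -> \bar R}) _) => //.
have ei0 : 0 <= (fine (P E))^-1 by rewrite invr_ge0 ltW.
have scE B' : mscale (NngNum ei0) m B' = ((fine (P E))^-1%:E * m B')%E by [].
have -> : (distribution P X \x distribution P Y)%E C = mscale (NngNum ei0) m C.
  apply: product_measure_unique => // A B mA mB.
  rewrite [LHS]scE mE'.
  rewrite (_ : _ `&` E = X @^-1` A `&` (Y @^-1` B `&` E)); last first.
    by rewrite setIA; congr (_ `&` _).
  rewrite indep// -[in X in (_ * (_ * (_ * X)))%E](fineK PEfin)/=.
  by rewrite muleCA [X in (_ * X)%E]muleCA -EFinM mulVf ?gt_eqF// mule1.
rewrite scE mE' -[in X in (_ * X)%E](fineK PEfin).
by rewrite muleC muleA -EFinM mulfV ?gt_eqF// mul1e.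
Qed.

Lemma joint_law (X Y : {RV P >-> R}) :
  (forall A B : set R, measurable A -> measurable B ->
    P (X @^-1` A `&` Y @^-1` B) = (P (X @^-1` A) * P (Y @^-1` B))%E) ->
  forall C : set (R * R), measurable C ->
  P [set w | C (X w, Y w)] = (distribution P X \x distribution P Y)%E C.
Proof.
move=> indep C mC; have := @joint_law_restricted X Y setT measurableT _ C mC.
rewrite setIT probability_setT mule1; apply=> A B mA mB.
by rewrite setIT mule1 indep.
Qed.

Lemma integral_mul_indep (X Y : {RV P >-> R}) (f : R -> \bar R) :
  (forall A B : set R, measurable A -> measurable B ->
    P (X @^-1` A `&` Y @^-1` B) = (P (X @^-1` A) * P (Y @^-1` B))%E) ->
  measurable_fun setT f -> (forall x, 0 <= f x)%E ->
  (\int[P]_w f (X w * Y w)%R =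
   \int[distribution P X]_x \int[distribution P Y]_y f (x * y)%R)%E.
Proof.
move=> indep mf f0.
have mXY : measurable_fun setT (fun w => (X w, Y w)) by exact: measurable_fun_pair.
pose g (z : R * R) := f (z.1 * z.2).
have mg : measurable_fun setT g.
  apply: measurableT_comp => //.
  by apply: measurable_funM; [exact: measurable_fst|exact: measurable_snd].
rewrite -(@fubini_tonelli1 _ _ _ _ _ _ _ g mg)//; last by move=> z; exact: f0.
transitivity (\int[pushforward P (fun w => (X w, Y w))]_z g z)%E.
  by rewrite (ge0_integral_pushforward mXY P measurableT mg)// => z _; exact: f0.
apply: eq_measure_integral => C mC _.
exact: (joint_law indep mC).
Qed.

End joint_law.

Section partial_products.
Context d (T : measurableType d) (R : realType) (P : probability T R).
Variables (n : nat) (xi : 'I_n -> {RV P >-> R}).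
Hypothesis xi_indep : mutually_independent P xi.

(** Indexed by all natural numbers, so that products over initial segments can be
handled by induction. *)
Definition partial_prod (j : nat) : {RV P >-> R} :=
  (\prod_(i < n | (i < j)%N) xi i : {mfun T >-> R}).

Lemma partial_prodE j w : partial_prod j w = \prod_(i < n | (i < j)%N) xi i w.
Proof.
by rewrite /partial_prod; elim/big_rec2: _ => // i y1 y2 _ <-.
Qed.

Lemma partial_prod0 w : partial_prod 0 w = 1.
Proof. by rewrite partial_prodE big_pred0. Qed.

Lemma partial_prodS (j : 'I_n) w : partial_prod j.+1 w = partial_prod j w * xi j w.
Proof.
rewrite !partial_prodE (bigD1 j)//= mulrC; congr (_ * _).
by apply: eq_bigl => i; rewrite ltnS ltn_neqAle andbC.
Qed.

Lemma partial_prod_full w : partial_prod n w = \prod_(i < n) xi i w.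
Proof. by rewrite partial_prodE; apply: eq_bigl => i; rewrite ltn_ord. Qed.

Let tail (j : nat) (B : 'I_n -> set R) : set T :=
  [set w | forall i : 'I_n, (j <= i)%N -> B i (xi i w)].

Let measurable_tail j B : (forall i, measurable (B i)) -> measurable (tail j B).
Proof.
move=> mB.
have -> : tail j B = \big[setI/setT]_(i < n | (j <= i)%N) (xi i @^-1` B i).
  apply/seteqP; split.
    by move=> w wB; rewrite -bigcap_seq_cond => i /= /andP[_ ji]; exact: wB.
  by move=> w; rewrite -bigcap_seq_cond => wB i ji; apply: wB; rewrite /= mem_index_enum.
apply: big_ind => //; first exact: measurableI.
by move=> i _; exact: measurable_funPTI.
Qed.

Let probability_tail j B : (forall i, measurable (B i)) ->
  P (tail j B) = (\prod_(i < n | (j <= i)%N) P (xi i @^-1` B i))%E.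
Proof.
move=> mB; transitivity (\prod_(i in finset (fun i : 'I_n => (j <= i)%N)) P (xi i @^-1` B i))%E.
  rewrite -xi_indep//; congr (P _); apply/seteqP; split => w wB i.
    by rewrite inE; exact: wB.
  by move=> ji; apply: wB; rewrite inE.
by apply: eq_bigl => i; rewrite inE.
Qed.

Let tail_single (j : 'I_n) (B : set R) :
  tail j (fun k => if k == j then B else setT) = xi j @^-1` B.
Proof.
apply/seteqP; split => [w wB|w wB k jk]; last by case: eqP => // ->.
by have := wB j (leqnn j); rewrite eqxx.
Qed.

(** Mutual independence speaks about the single variables only. Keeping all the
later variables in the statement makes it strong enough to be carried by
induction through the product with the next one. *)
Lemma partial_prod_tail_indep j : (j <= n)%N ->
  forall (A : set R) (B : 'I_n -> set R), measurable A -> (forall i, measurable (B i)) ->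
  P (partial_prod j @^-1` A `&` tail j B) = (P (partial_prod j @^-1` A) * P (tail j B))%E.
Proof.
elim: j => [_ A B mA mB|j ih jn A B mA mB].
  have [A1|A1] := pselect (A 1).
    rewrite (_ : partial_prod 0 @^-1` A = setT); last first.
      by apply/seteqP; split => // w _; rewrite /preimage/= partial_prod0.
    by rewrite setTI probability_setT mul1e.
  rewrite (_ : partial_prod 0 @^-1` A = set0); last first.
    by apply/seteqP; split => // w; rewrite /preimage/= partial_prod0.
  by rewrite set0I measure0 mul0e.
pose i := Ordinal jn.
have tailS (C : set R) : tail j (fun k => if k == i then C else B k) =
    xi i @^-1` C `&` tail j.+1 B.
  apply/seteqP; split => [w wB|w [wC wB] k jk].
    split; first by have := wB i (leqnn j); rewrite eqxx.
    move=> k jk; have := wB k (ltnW jk); rewrite ifF//.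
    by apply/eqP => ki; move: jk; rewrite ki ltnn.
  case: eqP => [->//|/eqP ki]; apply: wB.
  by rewrite ltn_neqAle jk andbT eq_sym.
have indep (A' C : set R) : measurable A' -> measurable C ->
    P (partial_prod j @^-1` A' `&` (xi i @^-1` C `&` tail j.+1 B)) =
    (P (partial_prod j @^-1` A') * (P (xi i @^-1` C) * P (tail j.+1 B)))%E.
  move=> mA' mC; have mB' k : measurable (if k == i then C else B k) by case: ifP.
  rewrite -tailS ih ?(ltnW jn)//; congr (_ * _)%E.
  rewrite !probability_tail// (bigD1 i)//= eqxx; congr (_ * _)%E.
  apply: eq_big => [k|k /andP[_ /negbTE ->]//].
  by rewrite ltn_neqAle eq_sym andbC.
have mtail : measurable (tail j.+1 B) by exact: measurable_tail.
pose C := [set z : R * R | A (z.1 * z.2)].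
have mC : measurable C.
  rewrite -[C]setTI; apply: (_ : measurable_fun setT (fun z : R * R => z.1 * z.2)) => //.
  by apply: measurable_funM; [exact: measurable_fst|exact: measurable_snd].
have E : partial_prod j.+1 @^-1` A = [set w | C (partial_prod j w, xi i w)].
  by apply/seteqP; split => w; rewrite /preimage/= (partial_prodS i).
rewrite E (joint_law_restricted mtail indep mC); congr (_ * _)%E.
rewrite -joint_law// => A' B' mA' mB'.
rewrite -(tail_single i) ih//; first exact: ltnW.
by move=> k; case: ifP.
Qed.

Lemma partial_prod_indep (j : 'I_n) (A B : set R) : measurable A -> measurable B ->
  P (partial_prod j @^-1` A `&` xi j @^-1` B) =
  (P (partial_prod j @^-1` A) * P (xi j @^-1` B))%E.
Proof.
move=> mA mB; rewrite -tail_single partial_prod_tail_indep//; first exact: ltnW.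
by move=> k; case: ifP.
Qed.

End partial_products.

(** * Measures with a density *)

Section density.
Context d (T : measurableType d) (R : realType).
Variables (lam mu : {measure set T -> \bar R}) (f : T -> R).
Hypotheses (mf : measurable_fun setT f) (f_ge0 : forall x, 0 <= f x).
Hypothesis muE : forall A, measurable A -> mu A = (\int[lam]_(x in A) (f x)%:E)%E.
Import HBNNSimple.

(** Monotone convergence from simple functions, for which the formula is the
definition of the density. *)
Lemma ge0_integral_density (g : T -> \bar R) :
  measurable_fun setT g -> (forall x, 0 <= g x)%E ->
  (\int[mu]_x g x = \int[lam]_x (g x * (f x)%:E))%E.
Proof.
move=> mg g0; pose h := nnsfun_approx measurableT mg.
have cvgh x : EFin \o h^~ x @ \oo --> g x by apply: cvg_nnsfun_approx.
have -> : (\int[mu]_x g x = limn (fun n => \int[mu]_x (h n x)%:E))%E.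
  under eq_integral => x _ do rewrite -(cvg_lim (@ereal_hausdorff _) (cvgh x)).
  apply: monotone_convergence => //.
  - by move=> n; apply/measurable_EFinP.
  - by move=> n x _; rewrite lee_fin.
  - by move=> x _ a b ab; rewrite lee_fin; exact/lefP/nd_nnsfun_approx.
have -> : (\int[lam]_x (g x * (f x)%:E) =
    limn (fun n => \int[lam]_x ((h n x)%:E * (f x)%:E)))%E.
  have cvghf x : (fun n => (h n x)%:E * (f x)%:E)%E @ \oo --> (g x * (f x)%:E)%E.
    by apply: cvgeZr => //; exact: cvgh.
  under eq_integral => x _ do rewrite -(cvg_lim (@ereal_hausdorff _) (cvghf x)).
  apply: monotone_convergence => //.
  - by move=> n; apply: emeasurable_funM; apply/measurable_EFinP.
  - by move=> n x _; rewrite -EFinM lee_fin mulr_ge0.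
  - move=> x _ a b ab; rewrite -!EFinM lee_fin ler_wpM2r//.
    exact/lefP/nd_nnsfun_approx.
congr (limn _); apply/funext => n.
under eq_integral do rewrite fimfunE -fsumEFin//.
rewrite ge0_integral_fsum//; last 2 first.
- by move=> r; exact/measurable_EFinP/measurableT_comp.
- by move=> r x _; rewrite EFinM nnfun_muleindic_ge0.
under [RHS]eq_integral.
  move=> x _; rewrite fimfunE -fsumEFin// ge0_mule_fsuml; last first.
    by move=> r; exact: nnfun_muleindic_ge0.
  over.
rewrite ge0_integral_fsum//; last 2 first.
- move=> r; apply: emeasurable_funM; last exact/measurable_EFinP.
  exact/measurable_EFinP/measurableT_comp.
- move=> r x _; apply: mule_ge0; last by rewrite lee_fin.
  by rewrite EFinM nnfun_muleindic_ge0.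
apply: eq_fsbigr => r rh.
have r0 : 0 <= r by move: rh; rewrite inE => -[x _ <-].
have mA : measurable (h n @^-1` [set r]) by exact: measurable_funPTI.
under eq_integral do rewrite EFinM.
rewrite ge0_integralZl//; last exact/measurable_EFinP.
under [RHS]eq_integral do rewrite EFinM -muleA.
rewrite ge0_integralZl//; last 2 first.
- by apply: emeasurable_funM; apply/measurable_EFinP.
- by move=> x _; rewrite -EFinM lee_fin mulr_ge0.
congr (_ * _)%E; rewrite integral_indic// setIT muE// integral_mkcond.
by apply: eq_integral => x _; rewrite epatch_indic muleC.
Qed.

End density.

Section scaling.
Context {R : realType}.
Local Notation leb := (@lebesgue_measure R).

(** Both sides, rescaled by [a], are measures agreeing on half-open intervals. *)
Lemma lebesgue_measure_scale (a : R) (A : set R) : 0 < a -> measurable A ->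
  leb (( *%R a) @^-1` A) = ((a^-1)%:E * leb A)%E.
Proof.
move=> a0 mA.
have ma : measurable_fun setT (( *%R a) : R -> measurableTypeR R).
  exact: measurable_funM.
have [m mE] : exists m : {measure set (measurableTypeR R) -> \bar R},
    forall C, m C = leb (( *%R a) @^-1` C).
  by unshelve refine (ex_intro _ (pushforward leb (( *%R a) : R -> measurableTypeR R)
    : {measure set (measurableTypeR R) -> \bar R}) _).
have a0' := ltW a0.
pose m' : {measure set (measurableTypeR R) -> \bar R} := mscale (NngNum a0') m.
have m'E C : m' C = (a%:E * leb (( *%R a) @^-1` C))%E by rewrite -mE.
have -> : leb A = m' A.
  apply: lebesgue_measure_unique => // _ [[b c] _ <-]; rewrite m'E/=.
  have -> : ( *%R a) @^-1` `]b, c]%classic = `](b / a), (c / a)]%classic.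
    apply/seteqP; split => x /=; rewrite !in_itv/= ltr_pdivrMr// ler_pdivlMr//;
      by rewrite mulrC.
  rewrite !lebesgue_measure_itv/= !lte_fin ltr_pM2r ?invr_gt0//.
  case: ifP => _; last by rewrite mule0.
  by rewrite -EFinM; congr EFin; field; rewrite gt_eqF.
by rewrite m'E muleA -EFinM mulVf ?gt_eqF// mul1e.
Qed.

Lemma ge0_integral_scale (a : R) (f : R -> \bar R) : 0 < a ->
  measurable_fun setT f -> (forall x, 0 <= f x)%E ->
  (\int[leb]_x f (a * x)%R = (a^-1)%:E * \int[leb]_x f x)%E.
Proof.
move=> a0 mf f0.
pose phi : measurableTypeR R -> measurableTypeR R := *%R a.
have mphi : measurable_fun setT phi by exact: measurable_funM.
have ai0 : 0 <= a^-1 by rewrite invr_ge0 ltW.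
rewrite -[RHS](@ge0_integral_mscale _ _ _ leb setT measurableT (NngNum ai0))//.
transitivity (\int[pushforward leb phi]_x f x)%E.
  by rewrite (ge0_integral_pushforward mphi leb measurableT)// => x _; exact: f0.
apply: eq_measure_integral => A mA _.
exact: lebesgue_measure_scale.
Qed.

End scaling.

Section lebesgue_density.
Context {R : realType}.
Local Notation leb := (@lebesgue_measure R).

(** The Borel structure of the real line and the one that carries the Lebesgue
measure are two instances on the same type, whence the transport along the
identity. *)
Lemma ge0_integral_lebesgue_density (mu : {measure set R -> \bar R}) (f : R -> R)
    (g : R -> \bar R) :
  measurable_fun setT f -> (forall x, 0 <= f x) ->
  (forall A : set R, measurable A -> mu A = (\int[leb]_(x in A) (f x)%:E)%E) ->
  measurable_fun setT g -> (forall x, 0 <= g x)%E ->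
  (\int[mu]_x g x = \int[leb]_x (g x * (f x)%:E))%E.
Proof.
move=> mf f0 muE mg g0; pose phi : R -> measurableTypeR R := id.
have mphi : measurable_fun setT phi by move=> _ B mB; rewrite setTI.
transitivity (\int[pushforward mu phi]_x g x)%E.
  by rewrite (ge0_integral_pushforward mphi mu measurableT)// => x _; exact: g0.
have [m mE] : exists m : {measure set (measurableTypeR R) -> \bar R},
    forall C, m C = pushforward mu phi C.
  by unshelve refine (ex_intro _ (pushforward mu phi
    : {measure set (measurableTypeR R) -> \bar R}) _).
rewrite -(@ge0_integral_density _ _ _ leb m f)//; last first.
  by move=> A mA; rewrite mE; exact: muE.
by apply: eq_measure_integral => A mA _; rewrite mE.
Qed.

End lebesgue_density.

(** * Laws minorized by a Weibull-type density *)

Section heavy_tails.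
Context {R : realType}.
Local Notation leb := (@lebesgue_measure R).
Implicit Types (C c dl x y z : R) (m : nat).

Definition weibull_density C c dl m : R -> R :=
  (fun x => C * (x ^+ m * expR (- (c * x `^ dl)))) \_ `]0, +oo[.

Lemma weibull_densityE C c dl m x : 0 < x ->
  weibull_density C c dl m x = C * (x ^+ m * expR (- (c * x `^ dl))).
Proof. by move=> x0; rewrite /weibull_density patchE mem_set//= in_itv/= x0. Qed.

Lemma weibull_density_le0 C c dl m x : x <= 0 -> weibull_density C c dl m x = 0.
Proof.
move=> x0; rewrite /weibull_density patchE memNset//= in_itv/= andbT.
by apply/negP; rewrite -leNgt.
Qed.

Lemma weibull_density_ge0 C c dl m x : 0 <= C -> 0 <= weibull_density C c dl m x.
Proof.
move=> C0; have [x0|x0] := ltP 0 x; last by rewrite weibull_density_le0.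
by rewrite weibull_densityE// !mulr_ge0 ?expR_ge0// exprn_ge0// ltW.
Qed.

Lemma measurable_weibull_density C c dl m (D : set R) :
  measurable_fun D (weibull_density C c dl m).
Proof.
apply: (measurable_funS measurableT) => //.
apply/(measurable_restrictT _ _).1 => //.
apply: (measurable_funS measurableT) => //.
apply: measurable_funM => //; apply: measurable_funM; first exact: measurable_funX.
apply: measurableT_comp => //; apply: measurableT_comp => //.
by apply: measurable_funM => //; exact: measurable_powR.
Qed.

Definition heavy_tailed m dl (mu : set R -> \bar R) : Prop :=
  exists C c, [/\ 0 < C, 0 < c & forall A : set R, measurable A ->
    (\int[leb]_(x in A) (weibull_density C c dl m x)%:E <= mu A)%E].

Section product.
Variables (m : nat) (C1 c1 d1 C2 c2 d2 : R).
Hypotheses (C1_gt0 : 0 < C1) (c1_gt0 : 0 < c1) (d1_gt0 : 0 < d1).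
Hypotheses (C2_gt0 : 0 < C2) (c2_gt0 : 0 < c2) (d2_gt0 : 0 < d2).
Let dl : R := (d1^-1 + d2^-1)^-1.
(* [z = x * (z / x)] with [x] of order [z ^ p] equalizes the two exponents:
   [p * d1 = (1 - p) * d2 = dl] *)
Let p : R := dl / d1.
(* lower bound for the density at [z] of the scaled variable [x * Y], uniform in
   [x] between [z ^ p] and [2 * z ^ p] *)
Let kappa z : R :=
  C2 * 2^-1 ^+ m.+1 * z `^ ((1 - p) * m%:R - p) * expR (- (c2 * z `^ dl)).

Let pd1 : p * d1 = dl. Proof. by rewrite /p divfK// gt_eqF. Qed.

Let pd2 : (1 - p) * d2 = dl.
Proof.
have h : d1 + d2 != 0 by rewrite gt_eqF// addr_gt0.
by rewrite /p /dl; field; rewrite !gt_eqF ?addr_gt0.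
Qed.

Let kappa_ge0 z : 0 <= kappa z.
Proof. by rewrite /kappa !mulr_ge0 ?expR_ge0 ?powR_ge0 ?exprn_ge0 ?invr_ge0// ltW. Qed.

Lemma kappa_le x z : 0 < z -> z `^ p <= x <= 2 * z `^ p ->
  kappa z <= x^-1 * weibull_density C2 c2 d2 m (z / x).
Proof.
move=> z0 /andP[zx xz].
have zp0 : 0 < z `^ p by exact: powR_gt0.
have x0 : 0 < x by exact: lt_le_trans zx.
have zx0 : 0 < z / x by rewrite divr_gt0.
rewrite weibull_densityE//.
have -> : kappa z = (2 * z `^ p)^-1 *
    (C2 * ((z `^ (1 - p) / 2) ^+ m * expR (- (c2 * z `^ dl)))).
  rewrite /kappa invfM -powRN expr_div_n -(powR_mulrn m (powR_ge0 z _)) -powRrM.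
  rewrite powRD; last by apply/implyP => _; rewrite gt_eqF.
  by rewrite exprS exprVn; ring.
apply: ler_pM.
- by rewrite invr_ge0 mulr_ge0// ltW.
- by rewrite !mulr_ge0 ?expR_ge0 ?exprn_ge0 ?divr_ge0 ?powR_ge0// ltW.
- by rewrite lef_pV2// posrE// mulr_gt0.
rewrite (ler_pM2l C2_gt0); apply: ler_pM.
- by rewrite exprn_ge0 ?divr_ge0 ?powR_ge0.
- exact: expR_ge0.
- rewrite lerXn2r ?nnegrE ?divr_ge0 ?powR_ge0//; [exact: ltW|exact: ltW|].
  rewrite powRB; last by apply/implyP => _; rewrite gt_eqF.
  rewrite (powRr1 (ltW z0)) -mulrA -invfM ler_pdivrMr ?mulr_gt0//.
  by rewrite mulrAC ler_pdivlMr// (ler_pM2l z0) mulrC.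
- rewrite ler_expR lerN2 (ler_pM2l c2_gt0) -[in leRHS]pd2 (powRrM z).
  rewrite ge0_ler_powR ?nnegrE ?powR_ge0//; [exact: ltW|exact: ltW|].
  rewrite powRB; last by apply/implyP => _; rewrite gt_eqF.
  by rewrite (powRr1 (ltW z0)) (ler_pM2l z0) lef_pV2 ?posrE.
Qed.

Lemma weibull_mass_ge (mu : {measure set R -> \bar R}) z : 0 < z ->
  (forall A : set R, measurable A ->
    (\int[leb]_(x in A) (weibull_density C1 c1 d1 m x)%:E <= mu A)%E) ->
  ((C1 * ((z `^ p) ^+ m * expR (- (c1 * 2 `^ d1 * z `^ dl))) * z `^ p)%:E <=
    mu (`[(z `^ p)%R, (2 * z `^ p)%R]%classic : set R))%E.
Proof.
move=> z0 mu_ge.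
have zp0 : 0 < z `^ p by exact: powR_gt0.
apply: le_trans (mu_ge _ _); last exact: measurable_itv.
set K := C1 * _.
have -> : ((K * z `^ p)%:E =
    \int[leb]_(x in `[(z `^ p)%R, (2 * z `^ p)%R]) K%:E)%E.
  rewrite integral_cst//= lebesgue_measure_itv/= lte_fin ltr_pMl// ltr1n -EFinB.
  by rewrite -EFinM; congr (EFin (_ * _)); ring.
apply: ge0_le_integral => //.
- by move=> x _; rewrite lee_fin /K !mulr_ge0 ?expR_ge0 ?exprn_ge0// ltW.
- by apply/measurable_EFinP; exact: measurable_weibull_density.
move=> x /=; rewrite in_itv/= => /andP[zx xz].
have x0 : 0 < x by exact: lt_le_trans zx.
rewrite lee_fin weibull_densityE// /K (ler_pM2l C1_gt0); apply: ler_pM.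
- by rewrite exprn_ge0// ltW.
- exact: expR_ge0.
- by rewrite lerXn2r ?nnegrE// ltW.
rewrite ler_expR lerN2 -mulrA (ler_pM2l c1_gt0) -pd1 (powRrM z) -powRM//; last exact: ltW.
by rewrite ge0_ler_powR ?nnegrE ?mulr_ge0// ltW.
Qed.

Lemma kappa_weibull z : 0 < z ->
  weibull_density (C1 * C2 * 2^-1 ^+ m.+1) (c2 + c1 * 2 `^ d1) dl m z =
  kappa z * (C1 * ((z `^ p) ^+ m * expR (- (c1 * 2 `^ d1 * z `^ dl))) * z `^ p).
Proof.
move=> z0; rewrite weibull_densityE// /kappa mulrDl opprD expRD.
rewrite -(powR_mulrn m (ltW z0)) -(powR_mulrn m (powR_ge0 z p)) -powRrM.
have zm : z `^ m%:R = z `^ ((1 - p) * m%:R - p) * z `^ (p * m%:R) * z `^ p.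
  rewrite -!powRD; [|by apply/implyP => _; rewrite gt_eqF..].
  by congr (_ `^ _); ring.
by rewrite zm; ring.
Qed.

(** The density of the product at [z] is the mean over [X = x] of the density of
[x * Y]. Only the values [x] between [z ^ p] and [2 * z ^ p] are kept: there the
latter density is at least [kappa z], and [X] has mass of the same exponential
order. *)
Lemma weibull_minorant_mul d (T : measurableType d) (P : probability T R)
    (X Y : {RV P >-> R}) :
  (forall A B : set R, measurable A -> measurable B ->
    P (X @^-1` A `&` Y @^-1` B) = (P (X @^-1` A) * P (Y @^-1` B))%E) ->
  (forall A : set R, measurable A ->
    (\int[leb]_(x in A) (weibull_density C1 c1 d1 m x)%:E <= distribution P X A)%E) ->
  (forall A : set R, measurable A ->
    (\int[leb]_(x in A) (weibull_density C2 c2 d2 m x)%:E <= distribution P Y A)%E) ->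
  forall A : set R, measurable A ->
  (\int[leb]_(z in A) (weibull_density (C1 * C2 * 2^-1 ^+ m.+1)%R
      (c2 + c1 * 2 `^ d1)%R dl m z)%:E <= P [set w | A (X w * Y w)%R])%E.
Proof.
move=> indep hX hY A mA.
set mu := distribution P X; set nu := distribution P Y.
have mindA : measurable_fun setT (\1_A : R -> R) by exact: measurable_indic.
have -> : P [set w | A (X w * Y w)] =
    (\int[mu]_x \int[nu]_y (\1_A (x * y)%R)%:E)%E.
  rewrite -(integral_mul_indep indep (f := fun x => (\1_A x)%:E))//; last first.
    exact/measurable_EFinP.
  have mXY : measurable [set w | A (X w * Y w)].
    rewrite -[X in measurable X]setTI.
    by apply: (measurable_funM (measurable_funPT X) (measurable_funPT Y)).
  transitivity (\int[P]_w (\1_[set w | A (X w * Y w)] w)%:E)%E.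
    by rewrite integral_indic// setIT.
  by apply: eq_integral => w _; rewrite !indicE; congr (_%:R%:E); apply/idP/idP; rewrite !inE.
pose g z : R := \1_A z * (kappa \_ `]0, +oo[) z.
have g_ge0 z : 0 <= g z.
  by rewrite mulr_ge0// patchE; case: ifP.
have mkappa : measurable_fun setT kappa.
  apply: measurable_funM; first by apply: measurable_funM => //; exact: measurable_powR.
  apply: measurableT_comp => //; apply: measurableT_comp => //.
  by apply: measurable_funM => //; exact: measurable_powR.
have mg : measurable_fun setT g.
  apply: measurable_funM => //; apply/(measurable_restrictT _ _).1 => //.
  exact: measurable_funS mkappa.
pose S : set (R * R) := [set u | u.2 `^ p <= u.1 <= 2 * u.2 `^ p].
have mS : measurable S.
  have mp : measurable_fun setT (fun u : R * R => u.2 `^ p).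
    apply: (measurableT_comp (measurable_powR p)); exact: measurable_snd.
  have -> : S = [set u : R * R | u.2 `^ p <= u.1] `&` [set u | u.1 <= 2 * u.2 `^ p].
    by apply/seteqP; split => u; [move=> /andP[]|move=> [? ?]; apply/andP].
  apply: measurableI; rewrite -[X in measurable X]setTI; apply: measurable_fun_le => //.
    by apply: measurable_funM.
pose K (u : R * R) : \bar R := (g u.2 * \1_S u)%:E.
have mK : measurable_fun setT K.
  apply/measurable_EFinP; apply: measurable_funM; last exact: measurable_indic.
  by apply: measurableT_comp => //; exact: measurable_snd.
have K_ge0 u : (0 <= K u)%E by rewrite lee_fin mulr_ge0.
(* disintegrate along [X], replacing the law of [Y] by its density *)
have step1 x : (\int[leb]_z K (x, z) <= \int[nu]_y (\1_A (x * y)%R)%:E)%E.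
  have [x0|x0] := ltP 0 x; last first.
    rewrite integral0_eq; first by apply: integral_ge0 => y _; rewrite lee_fin.
    move=> z _; rewrite /K /g; have [z0|z0] := ltP 0 z; last first.
      rewrite (patchE kappa) memNset ?mulr0 ?mul0r//= in_itv/= andbT.
      by apply/negP; rewrite -leNgt.
    rewrite [X in _ * X]indicE memNset ?mulr0// /S /= => /andP[zx _].
    by have := lt_le_trans (powR_gt0 p z0) zx; rewrite ltNge x0.
  pose B := ( *%R x) @^-1` A.
  have mB : measurable (B : set R).
    have mx : measurable_fun setT ( *%R x : R -> R) by exact: measurable_funM.
    by rewrite -[B]setTI; exact: mx.
  have -> : (\int[nu]_y (\1_A (x * y)%R)%:E = nu B)%E.
    transitivity (\int[nu]_y (\1_B y)%:E)%E; first by [].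
    by rewrite integral_indic// setIT.
  apply: le_trans (hY _ mB).
  pose F z : \bar R := (\1_A z * weibull_density C2 c2 d2 m (z / x))%:E.
  have F0 z : (0 <= F z)%E.
    by rewrite lee_fin mulr_ge0// weibull_density_ge0// ltW.
  have mF : measurable_fun setT F.
    apply/measurable_EFinP; apply: measurable_funM => //.
    apply: measurableT_comp; first exact: measurable_weibull_density.
    exact: measurable_funM.
  have -> : (\int[leb]_(y in B) (weibull_density C2 c2 d2 m y)%:E =
      \int[leb]_y F (x * y)%R)%E.
    rewrite integral_mkcond; apply: eq_integral => y _.
    rewrite epatch_indic muleC -EFinM /F mulrAC divff ?mul1r ?gt_eqF//.
  rewrite ge0_integral_scale// -ge0_integralZl//; last by rewrite lee_fin invr_ge0 ltW.
  apply: ge0_le_integral => //.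
  - exact: (measurableT_comp mK (measurable_pair1 x)).
  - exact: measurable_funeM.
  move=> z _; rewrite -EFinM lee_fin mulrCA.
  rewrite /K /g -mulrA; apply: ler_wpM2l => //.
  have w0 : 0 <= x^-1 * weibull_density C2 c2 d2 m (z / x).
    by rewrite mulr_ge0 ?invr_ge0 ?weibull_density_ge0// ltW.
  rewrite patchE; case: ifPn => [|_]; last by rewrite mul0r.
  rewrite inE/= in_itv/= andbT => z0; rewrite indicE.
  have [|_] := boolP ((x, z) \in S); last by rewrite mulr0.
  by rewrite inE => zS; rewrite mulr1; exact: kappa_le.
have step2 z : ((\1_A z * weibull_density (C1 * C2 * 2^-1 ^+ m.+1)
    (c2 + c1 * 2 `^ d1) dl m z)%R%:E <= \int[mu]_x K (x, z))%E.
  have [z0|z0] := ltP 0 z; last first.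
    by rewrite weibull_density_le0// mulr0; apply: integral_ge0.
  rewrite kappa_weibull// (mulrA (\1_A z)).
  have gE : \1_A z * kappa z = g z.
    by rewrite /g patchE mem_set//= in_itv/= z0.
  rewrite gE /K /=; under eq_integral do rewrite EFinM.
  have IS x : (\1_S (x, z) : R) = \1_(`[z `^ p, 2 * z `^ p]%classic) x.
    by rewrite !indicE; congr (_%:R); apply/idP/idP; rewrite !inE/= in_itv.
  under eq_integral do rewrite IS.
  have mI : measurable (`[z `^ p, 2 * z `^ p]%classic : set R) by exact: measurable_itv.
  rewrite ge0_integralZl; [|by []|by apply/measurable_EFinP|
    by move=> *; rewrite lee_fin|by rewrite lee_fin].
  rewrite integral_indic// setIT EFinM lee_wpmul2l ?lee_fin//.
  exact: weibull_mass_ge.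
apply: (@le_trans _ _ (\int[mu]_x \int[leb]_z K (x, z))%E); last first.
  apply: ge0_le_integral => //.
  - by move=> x _; apply: integral_ge0 => z _.
  - exact: (measurable_fun_fubini_tonelli_F (m2 := leb) K mK K_ge0).
  - have mK2 : measurable_fun setT (fun u : R * R => (\1_A (u.1 * u.2)%R)%:E : \bar R).
      apply/measurable_EFinP; apply: measurableT_comp => //.
      by apply: measurable_funM; [exact: measurable_fst|exact: measurable_snd].
    apply: (measurable_fun_fubini_tonelli_F (m2 := nu) _ mK2) => u.
    by rewrite lee_fin.
have -> : (\int[mu]_x \int[leb]_z K (x, z) = \int[leb]_z \int[mu]_x K (x, z))%E.
  exact: (fubini_tonelli (m1 := mu) (m2 := leb) K mK K_ge0).
rewrite integral_mkcond; apply: ge0_le_integral => //.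
- move=> z _; rewrite patchE; case: ifP => // _.
  by rewrite lee_fin weibull_density_ge0// !mulr_ge0// ltW.
- apply/(measurable_restrictT _ _).1 => //; apply/measurable_EFinP.
  exact: measurable_weibull_density.
- exact: (measurable_fun_fubini_tonelli_G (m1 := mu) K mK K_ge0).
- move=> z _; apply: le_trans (step2 z).
  by rewrite patchE indicE; case: ifP => _; rewrite /= ?mul1r ?mul0r.
Qed.

End product.

Lemma heavy_tailed_mul m d1 d2 d (T : measurableType d) (P : probability T R)
    (X Y Z : {RV P >-> R}) : 0 < d1 -> 0 < d2 ->
  (forall A B : set R, measurable A -> measurable B ->
    P (X @^-1` A `&` Y @^-1` B) = (P (X @^-1` A) * P (Y @^-1` B))%E) ->
  (forall w, Z w = X w * Y w) ->
  heavy_tailed m d1 (distribution P X) -> heavy_tailed m d2 (distribution P Y) ->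
  heavy_tailed m (d1^-1 + d2^-1)^-1 (distribution P Z).
Proof.
move=> d10 d20 indep ZE [C1 [c1 [C10 c10 hX]]] [C2 [c2 [C20 c20 hY]]].
exists (C1 * C2 * 2^-1 ^+ m.+1), (c2 + c1 * 2 `^ d1); split.
- by rewrite !mulr_gt0// exprn_gt0// invr_gt0.
- by rewrite addr_gt0// mulr_gt0// powR_gt0.
move=> A mA; have := weibull_minorant_mul C10 c10 d10 C20 c20 d20 indep hX hY mA.
move=> /le_trans; apply; rewrite le_eqVlt; apply/orP; left; apply/eqP.
by congr (P _); apply/seteqP; split => w /=; rewrite ZE.
Qed.

End heavy_tails.

(** * Generalized gamma laws *)

Section gengamma_law.
Context {R : realType}.
Local Notation leb := (@lebesgue_measure R).
Variables (a b g : R) (mu : probability R R).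
Hypotheses (a_gt0 : 0 < a) (b_gt0 : 0 < b) (g_gt0 : 0 < g).
Hypothesis muE : forall A : set R, measurable A ->
  mu A = (\int[leb]_(x in A) (gengamma_pdf a b g x)%:E)%E.

Let c0 : R := b * a `^ (g / b) / gamma_fun (g / b).

Lemma gengamma_pdfE x : 0 <= x ->
  gengamma_pdf a b g x = c0 * (x `^ (g - 1) * expR (- (a * x `^ b))).
Proof. by move=> x0; rewrite /gengamma_pdf patchE mem_set//= in_itv/= x0. Qed.

Lemma gengamma_pdf_lt0 x : x < 0 -> gengamma_pdf a b g x = 0.
Proof.
move=> x0; rewrite /gengamma_pdf patchE memNset//= in_itv/= andbT.
by apply/negP; rewrite -ltNge.
Qed.

Lemma measurable_gengamma_pdf (D : set R) : measurable_fun D (gengamma_pdf a b g).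
Proof.
apply: (measurable_funS measurableT) => //.
apply/(measurable_restrictT _ _).1 => //.
by apply: measurable_funM => //; exact: measurable_powR_expR.
Qed.

(** Read off the total mass, which could not be [1] if the density were
nonpositive. *)
Lemma gengamma_norming_gt0 : 0 < c0.
Proof.
rewrite ltNge; apply/negP => c00.
have h x : (0 <= - (gengamma_pdf a b g x)%:E)%E.
  rewrite -EFinN lee_fin oppr_ge0; have [x0|x0] := leP 0 x; last by rewrite gengamma_pdf_lt0.
  by rewrite gengamma_pdfE// mulr_le0_ge0// mulr_ge0 ?powR_ge0 ?expR_ge0.
have := muE measurableT; rewrite probability_setT => /esym.
have -> : (\int[leb]_x (gengamma_pdf a b g x)%:E =
  - \int[leb]_x (- (gengamma_pdf a b g x)%:E))%E.
  rewrite -integral_ge0N => [|x _]; last exact: h.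
  by apply: eq_integral => x _; rewrite oppeK.
have I0 : (0 <= \int[leb]_x - (gengamma_pdf a b g x)%:E)%E.
  by apply: integral_ge0 => x _.
by move=> H; move: I0; rewrite -oppe_le0 H leNgt lte01.
Qed.

Lemma gengamma_pdf_ge0 x : 0 <= gengamma_pdf a b g x.
Proof.
have [x0|x0] := leP 0 x; last by rewrite gengamma_pdf_lt0.
rewrite gengamma_pdfE//; apply: mulr_ge0; first exact: ltW gengamma_norming_gt0.
by rewrite mulr_ge0 ?powR_ge0 ?expR_ge0.
Qed.

Lemma gengamma_ae_ge0 : {ae mu, forall x, 0 <= x}.
Proof.
exists (`]-oo, 0[%classic : set R); split; first exact: measurable_itv.
  rewrite muE; last exact: measurable_itv.
  apply: integral0_eq => x /=; rewrite in_itv/= => x0.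
  by rewrite gengamma_pdf_lt0.
by move=> x /= /negP; rewrite -ltNge in_itv.
Qed.

Lemma integrable_gengamma_pdf : leb.-integrable setT (EFin \o gengamma_pdf a b g).
Proof.
apply: integrable_lt_pinfty => //; first exact: measurable_gengamma_pdf.
  by move=> x _; exact: gengamma_pdf_ge0.
by rewrite -muE// probability_setT ltry.
Qed.

(** Half of the exponential rate survives. For [`|x| <= 1] the density itself
dominates, which copes with the singularity at [0] when [g < 1]; for [x > 1] the
factor [x ^ (g - 1)] is at most [x ^ g]. *)
Lemma gengamma_expR_moment :
  (\int[mu]_x (expR (a / 2 * `|x| `^ b))%:E < +oo)%E.
Proof.
have mE : measurable_fun setT (fun x : R => expR (a / 2 * `|x| `^ b)).
  apply: measurableT_comp => //; apply: measurable_funM => //.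
  by apply: (measurableT_comp (measurable_powR b)); exact: normr_measurable.
rewrite (@ge0_integral_lebesgue_density _ mu (gengamma_pdf a b g)); last 5 first.
- exact: measurable_gengamma_pdf.
- exact: gengamma_pdf_ge0.
- exact: muE.
- exact/measurable_EFinP.
- by move=> x; rewrite lee_fin expR_ge0.
pose w := (fun x : R => x `^ g * expR (- (a / 2 * x `^ b))) \_ `]0, +oo[.
have a20 : 0 < a / 2 by rewrite divr_gt0.
have Iw : leb.-integrable setT (EFin \o w).
  have := integrable_powR_expR (ltW g_gt0) a20 b_gt0.
  move=> /(integrable_mkcond _ _).1; rewrite restrict_EFin; apply.
  exact: measurable_itv.
have c00 := gengamma_norming_gt0.
have Ih : leb.-integrable setT
    (EFin \o (fun x => expR (a / 2) * gengamma_pdf a b g x + c0 * w x)).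
  apply: integrable_EFinD => //; apply: integrable_EFinZ => //.
  exact: integrable_gengamma_pdf.
have If : leb.-integrable setT
    (EFin \o (fun x => expR (a / 2 * `|x| `^ b) * gengamma_pdf a b g x)).
  apply: integrable_le Ih => //.
    by apply: measurable_funM => //; exact: measurable_gengamma_pdf.
  move=> x _; rewrite ger0_norm ?mulr_ge0 ?expR_ge0 ?gengamma_pdf_ge0//.
  have w0 : 0 <= w x.
    by rewrite /w patchE; case: ifP => // _; rewrite mulr_ge0 ?powR_ge0 ?expR_ge0.
  have [x1|x1] := leP `|x| 1.
    apply: ler_wpDr; first exact: (mulr_ge0 (ltW c00) w0).
    rewrite ler_wpM2r ?gengamma_pdf_ge0//.
    rewrite ler_expR ler_piMr ?(ltW a20)//.
    have : `|x| `^ b <= 1 `^ b by rewrite ge0_ler_powR ?nnegrE//; exact: ltW.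
    by rewrite powR1.
  have [x0|x0] := leP x 0.
    have xlt0 : x < 0.
      by rewrite lt_neqAle x0 andbT; apply/eqP => xE; move: x1; rewrite xE normr0 ltr10.
    by rewrite gengamma_pdf_lt0// !mulr0 add0r; exact: (mulr_ge0 (ltW c00) w0).
  move: x1; rewrite gtr0_norm// => x1.
  apply: ler_wpDl; first by rewrite mulr_ge0 ?expR_ge0 ?gengamma_pdf_ge0.
  rewrite gengamma_pdfE ?(ltW x0)// mulrCA (ler_pM2l c00).
  rewrite /w patchE mem_set/=; last by rewrite in_itv/= x0.
  rewrite mulrCA -expRD; apply: ler_pM; rewrite ?powR_ge0 ?expR_ge0//.
    by apply: ler_powR; [exact: ltW|rewrite gerBl].
  by rewrite ler_expR; lra.
have /integrableP[_] := If.
under eq_integral => x _.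
  rewrite /= ger0_norm ?mulr_ge0 ?expR_ge0 ?gengamma_pdf_ge0// EFinM.
  over.
by [].
Qed.

(** The maximum of [x ^ k / exp (a / 2 * x ^ b)] has the announced order. For
[k = 0] the bound reads [1], by the convention [0 `^ 0 = 1]. *)
Lemma gengamma_moment_growth : exists2 L : R, 0 <= L & forall k,
  (\int[mu]_x (`|x| ^+ k)%:E <= (L ^+ k * k%:R `^ (k%:R / b))%:E)%E.
Proof.
have [M M0 ME] : exists2 M : R, 0 <= M &
    (\int[mu]_x (expR (a / 2 * `|x| `^ b))%:E = M%:E)%E.
  have := gengamma_expR_moment.
  have : (0 <= \int[mu]_x (expR (a / 2 * `|x| `^ b))%:E)%E.
    by apply: integral_ge0 => x _; rewrite lee_fin expR_ge0.
  by case: (integral _ _ _) => [M M0 _| |]//; exists M.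
have a20 : 0 < a / 2 by rewrite divr_gt0.
pose L0 := (a / 2 * b)^-1 `^ b^-1.
exists (Num.max 1 M * L0); first by rewrite mulr_ge0 ?powR_ge0// le_max ler01.
have mE : measurable_fun setT (fun x : R => expR (a / 2 * `|x| `^ b)).
  apply: measurableT_comp => //; apply: measurable_funM => //.
  by apply: (measurableT_comp (measurable_powR b)); exact: normr_measurable.
case=> [|k].
  rewrite expr0 mul1r mul0r powRr0.
  under eq_integral do rewrite expr0.
  by rewrite integral_cst// mul1e; exact: probability_le1.
have mk x : `|x| ^+ k.+1 <=
    (k.+1%:R / (a / 2 * b)) `^ (k.+1%:R / b) * expR (a / 2 * `|x| `^ b).
  by rewrite -powR_mulrn//; apply: powR_le_expR.
apply: (@le_trans _ _ (\int[mu]_x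
    (((k.+1%:R / (a / 2 * b)) `^ (k.+1%:R / b))%:E * (expR (a / 2 * `|x| `^ b))%:E))%E).
  apply: ge0_le_integral => //.
  - by apply/measurable_EFinP; apply: measurable_funX; exact: normr_measurable.
  - by apply: measurable_funeM; exact/measurable_EFinP.
  - by move=> x _; rewrite -EFinM lee_fin.
rewrite ge0_integralZl//; last 2 first.
- exact/measurable_EFinP.
- by rewrite lee_fin powR_ge0.
rewrite ME -EFinM lee_fin powRM ?ler0n//; last by rewrite invr_ge0 mulr_ge0// ltW.
have -> : (a / 2 * b)^-1 `^ (k.+1%:R / b) = L0 ^+ k.+1.
  by rewrite -powR_mulrn ?powR_ge0// /L0 -powRrM (mulrC b^-1).
rewrite exprMn -[leRHS]mulrA (mulrC (L0 ^+ _)) [leLHS]mulrC ler_wpM2r//.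
  by rewrite mulr_ge0 ?exprn_ge0 ?powR_ge0.
rewrite exprS; apply: (@le_trans _ _ (Num.max 1 M)); first by rewrite le_max lexx orbT.
by rewrite ler_peMr ?exprn_ege1 ?le_max ?lexx ?ler01.
Qed.

(** Raising the exponent of [x] to a natural number is paid for by an increase of
the exponential rate, which makes factors with different [g] comparable. *)
Lemma gengamma_heavy_tailed m : g - 1 <= m%:R -> heavy_tailed m b mu.
Proof.
move=> gm; have mg0 : 0 <= m%:R - (g - 1) by rewrite subr_ge0.
have [K K0 hK] := powR_bounded_expR mg0 ltr01 b_gt0.
have c00 := gengamma_norming_gt0.
have K1 : 0 < K + 1 by rewrite ltr_wpDl.
exists (c0 / (K + 1)), (a + 1); split; first by rewrite divr_gt0.
  by rewrite addr_gt0.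
move=> A mA; rewrite muE//; apply: ge0_le_integral => //.
- by move=> x _; rewrite lee_fin weibull_density_ge0// divr_ge0// ltW.
- by apply/measurable_EFinP; exact: measurable_weibull_density.
- by apply/measurable_EFinP; exact: measurable_gengamma_pdf.
move=> x _; rewrite lee_fin; have [x0|x0] := leP x 0.
  by rewrite weibull_density_le0// gengamma_pdf_ge0.
rewrite weibull_densityE// gengamma_pdfE ?(ltW x0)// -mulrA (ler_pM2l c00).
rewrite ler_pdivrMl// -powR_mulrn ?(ltW x0)//.
have -> : x `^ m%:R = x `^ (g - 1) * x `^ (m%:R - (g - 1)).
  by rewrite -powRD ?(gt_eqF x0) ?implybT// addrC subrK.
rewrite (mulrDl a) (opprD (a * _)) (expRD (- (a * _))) (expRN (1 * _)).
rewrite [leLHS](_ : _ = x `^ (g - 1) * expR (- (a * x `^ b)) *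
   (x `^ (m%:R - (g - 1)) / expR (1 * x `^ b))); last by ring.
rewrite mulrC ler_wpM2r ?mulr_ge0 ?powR_ge0 ?expR_ge0//.
rewrite ler_pdivrMr ?expR_gt0//; apply: le_trans (hK _ (ltW x0)) _.
by rewrite ler_wpM2r ?expR_ge0// lerDl.
Qed.

End gengamma_law.

(** * Moments and tails of the product *)

Section product_bounds.
Context d (T : measurableType d) (R : realType) (P : probability T R).

Lemma abs_moment_mul (X Y : {RV P >-> R}) k :
  (forall A B : set R, measurable A -> measurable B ->
    P (X @^-1` A `&` Y @^-1` B) = (P (X @^-1` A) * P (Y @^-1` B))%E) ->
  (\int[P]_w (`|X w * Y w| ^+ k)%:E =
   \int[distribution P X]_x (`|x| ^+ k)%:E * \int[distribution P Y]_x (`|x| ^+ k)%:E)%E.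
Proof.
move=> indep.
have mk : measurable_fun setT (fun x : R => (`|x| ^+ k)%:E : \bar R).
  by apply/measurable_EFinP; exact: measurable_normX.
rewrite (integral_mul_indep indep (f := fun x => (`|x| ^+ k)%:E))//.
rewrite -ge0_integralZr//; last by apply: integral_ge0.
apply: eq_integral => x _; rewrite -ge0_integralZl//.
by apply: eq_integral => y _; rewrite normrM exprMn EFinM.
Qed.

Lemma sum_lt_ordS n (F : 'I_n -> R) (j : 'I_n) :
  \sum_(i < n | (i < j.+1)%N) F i = F j + \sum_(i < n | (i < j)%N) F i.
Proof.
rewrite (bigD1 j)//=; congr (_ + _).
by apply: eq_bigl => i; rewrite ltnS ltn_neqAle andbC.
Qed.

Variables (n : nat) (xi : 'I_n -> {RV P >-> R}).
Hypothesis xi_indep : mutually_independent P xi.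
Variable b : 'I_n -> R.
Hypothesis b_gt0 : forall i, 0 < b i.

Lemma partial_prod_moment_growth j : (j <= n)%N ->
  (forall i, exists2 L : R, 0 <= L & forall k,
    (\int[distribution P (xi i)]_x (`|x| ^+ k)%:E <=
      (L ^+ k * k%:R `^ (k%:R / b i))%:E)%E) ->
  exists2 L : R, 0 <= L & forall k,
    (\int[distribution P (partial_prod xi j)]_x (`|x| ^+ k)%:E <=
      (L ^+ k * k%:R `^ (k%:R * \sum_(i < n | (i < j)%N) (b i)^-1))%:E)%E.
Proof.
move=> + hxi; elim: j => [_|j ih jn].
  exists 1 => // k; rewrite ge0_integral_distribution//=; last first.
    by apply/measurable_EFinP; exact: measurable_normX.
  under eq_integral do rewrite partial_prod0 normr1 expr1n.
  rewrite integral_cst// mul1e big_pred0// mulr0 powRr0 expr1n mulr1.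
  exact: probability_le1.
have [L L0 hL] := ih (ltnW jn); pose i := Ordinal jn; have [L' L'0 hL'] := hxi i.
exists (L * L') => [|k]; first exact: mulr_ge0.
rewrite ge0_integral_distribution//=; last first.
  by apply/measurable_EFinP; exact: measurable_normX.
under eq_integral do rewrite (partial_prodS xi i).
rewrite abs_moment_mul; last exact: (partial_prod_indep xi_indep).
apply: (le_trans (lee_pmul _ _ (hL k) (hL' k))).
- by apply: integral_ge0.
- by apply: integral_ge0.
rewrite -EFinM lee_fin (sum_lt_ordS _ i)/=.
set s : R := \sum_(_ < n | _) _.
rewrite mulrDr exprMn; case: k => [|k]; first by rewrite !mul0r addr0 !powRr0 !expr0 !mulr1.
by rewrite powRD ?pnatr_eq0 ?implybT// mulrACA (mulrC (_ `^ _)).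
Qed.

Lemma partial_prod_heavy_tailed m j : (0 < j <= n)%N ->
  (forall i, heavy_tailed m (b i) (distribution P (xi i))) ->
  heavy_tailed m (\sum_(i < n | (i < j)%N) (b i)^-1)^-1
    (distribution P (partial_prod xi j)).
Proof.
move=> + hxi; elim: j => // j ih /= jn; pose i := Ordinal jn.
rewrite (sum_lt_ordS _ i)/=.
have [j0|j0] := posnP j.
  rewrite big_pred0 => [|l]; last by rewrite j0.
  rewrite addr0 invrK; have [C [c [C0 c0 hC]]] := hxi i.
  exists C, c; split => // A mA; apply: le_trans (hC A mA) _.
  rewrite le_eqVlt; apply/orP; left; apply/eqP; congr (P _).
  by apply/seteqP; split => w /=; rewrite (partial_prodS xi i)/= j0 partial_prod0 mul1r.
set s : R := \sum_(_ < n | _) _.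
have s0 : 0 < s.
  rewrite /s (bigD1 (Ordinal (leq_trans j0 (ltnW jn))))//=.
  by rewrite ltr_pwDl ?invr_gt0// sumr_ge0// => l _; rewrite invr_ge0 ltW.
have -> : ((b i)^-1 + s)^-1 = ((s^-1)^-1 + (b i)^-1)^-1 by rewrite invrK addrC.
apply: heavy_tailed_mul (partial_prodS xi i) _ (hxi i) => //.
- by rewrite invr_gt0.
- exact: (partial_prod_indep xi_indep).
- by apply: ih; rewrite j0 ltnW.
Qed.

End product_bounds.

(** [k ^ k <= exp k * k!] and [k! ^ 2 <= (2 k)!]. *)
Lemma powR_nat_le_fact {R : realType} (B : R) k : B <= 2 ->
  k%:R `^ (k%:R * B) <= expR 2 ^+ k * (k.*2)`!%:R.
Proof.
case: k => [|k] B2; first by rewrite mul0r powRr0 expr0 mul1r fact0.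
set K := k.+1; have K0 : (0 < K)%N by [].
apply: (@le_trans _ _ ((K%:R ^+ K) ^+ 2)).
  rewrite -exprM -powR_mulrn ?ler0n// natrM; apply: ler_powR; first by rewrite ler1n.
  by rewrite ler_pM2l ?ltr0n.
have h : K%:R ^+ K <= expR K%:R * (K`!)%:R :> R.
  rewrite -ler_pdivrMr ?ltr0n ?fact_gt0//.
  by apply: le_trans (expR_ge1Dxn k (ler0n R K)); rewrite lerDr.
apply: (@le_trans _ _ ((expR K%:R * (K`!)%:R) ^+ 2)).
  by rewrite lerXn2r ?nnegrE ?mulr_ge0 ?expR_ge0 ?exprn_ge0.
rewrite exprMn -!expRM_natl (mulrC K%:R) -natrX ler_wpM2l ?expR_ge0//.
rewrite ler_nat -addnn -(bin_fact (leq_addr K K)) addnK mulnn.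
by rewrite leq_pmull// bin_gt0 leq_addr.
Qed.

(** * Determinacy from moment growth *)

Section moments_of_a_random_variable.
Context d (T : measurableType d) (R : realType) (P : probability T R).

Lemma law_ae_ge0 (X : {RV P >-> R}) :
  {ae distribution P X, forall x, 0 <= x} <-> {ae P, forall w, 0 <= X w}.
Proof.
have mN : measurable (`]-oo, 0[%classic : set R) by exact: measurable_itv.
have mXN : measurable (X @^-1` `]-oo, 0[%classic).
  by rewrite -[X in measurable X]setTI; exact: measurable_funPT.
split=> -[A [mA A0 NA]].
  exists (X @^-1` A); split => //.
  - by rewrite -[X in measurable X]setTI; exact: measurable_funPT.
  - by move=> w /= h; apply: NA.
exists (`]-oo, 0[%classic); split => //.
- apply/eqP; rewrite eq_le measure_ge0 andbT -A0.
  apply: (@le_measure _ _ _ P _ _); rewrite ?inE// => w /=.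
  by rewrite in_itv/= ltNge => /negP; exact: NA.
- by move=> x /= h; rewrite in_itv/= ltNge; apply/negP.
Qed.

Lemma finite_moments_of_abs (X : {RV P >-> R}) :
  (forall k, \int[distribution P X]_x (`|x| ^+ k)%:E < +oo)%E ->
  finite_moments P X.
Proof.
move=> h k _; have mX : measurable_fun setT (fun w => X w ^+ k).
  by apply: measurable_funX; exact: measurable_funPT.
apply/integrableP; split; first exact/measurable_EFinP.
have := h k; rewrite ge0_integral_distribution//; last first.
  by apply/measurable_EFinP; exact: measurable_normX.
by under eq_integral do rewrite /= -normrX.
Qed.

Lemma integrable_law (X : {RV P >-> R}) (f : R -> R) : measurable_fun setT f ->
  P.-integrable setT (EFin \o (f \o X)) ->
  (distribution P X).-integrable setT (EFin \o f).
Proof.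
move=> mf /integrableP[_ fX]; apply/integrableP; split; first exact/measurable_EFinP.
rewrite ge0_integral_distribution//.
by apply: measurableT_comp => //; exact/measurable_EFinP.
Qed.

Lemma agree_of_moments (X : {RV P >-> R}) (Q : probability R R) :
  finite_moments P X ->
  (forall k : nat, (0 < k)%N ->
    (Q.-integrable setT (fun x : R => (x ^+ k)%:E) /\
     'E_Q[fun x : R => (x ^+ k)%R] = 'E_P[fun w => (X w ^+ k)%R])%E) ->
  forall k, agree Q (distribution P X) (fun x => x ^+ k).
Proof.
move=> mom same [|k]; first exact: agree_cst.
have [IQ EQ] := same k.+1 isT; have IP := mom k.+1 isT.
have mk : measurable_fun setT (fun x : R => x ^+ k.+1) by exact: measurable_funX.
split => //; first exact: (@integrable_law X (fun x => x ^+ k.+1)).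
move: EQ; rewrite unlock /Rintegral => ->.
by rewrite integral_distribution//; exact/measurable_EFinP.
Qed.

Lemma moment_determinate_of_growth (X : {RV P >-> R}) (D : R) :
  {ae P, forall w, 0 <= X w} -> 0 <= D ->
  (forall k, \int[distribution P X]_x (`|x| ^+ k)%:E <=
    (D ^+ k * (k.*2)`!%:R)%:E)%E ->
  moment_determinate P X.
Proof.
move=> /law_ae_ge0 X0 D0 growth.
have mom : finite_moments P X.
  by apply: finite_moments_of_abs => k; apply: le_lt_trans (growth k) _; rewrite ltry.
split=> // Q /(agree_of_moments mom) same.
exact: half_line_determinate growth _ same.
Qed.

End moments_of_a_random_variable.

(** * Perturbing a law by a signed density *)

Section perturbation.
Context {R : realType}.
Local Notation leb := (@lebesgue_measure R).

Lemma exists_density_measure (f : R -> R) :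
  measurable_fun setT f -> (forall x, 0 <= f x) ->
  exists nu : {measure set R -> \bar R}, forall A : set R, measurable A ->
    nu A = (\int[leb]_(x in A) (f x)%:E)%E.
Proof.
move=> mf f0; pose nu (A : set R) : \bar R := (\int[leb]_(x in A) (f x)%:E)%E.
have nu0 : nu set0 = 0%E by exact: integral_set0.
have nu_ge0 A : (0 <= nu A)%E by apply: integral_ge0 => x _; rewrite lee_fin.
have nu_sadd : semi_sigma_additive nu.
  apply: (@semi_sigma_additive_nng_induced _ _ R leb (EFin \o f)).
    exact/measurable_EFinP.
  by move=> x; rewrite lee_fin.
pose nuM := isMeasure.Build _ _ _ nu nu0 nu_ge0 nu_sadd.
pose m : {measure set R -> \bar R} := HB.pack nu nuM.
by exists m.
Qed.

Variables (mu : probability R R) (h : R -> R).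
Hypothesis h_int : leb.-integrable setT (EFin \o h).
Hypothesis h_ge : forall A : set R, measurable A ->
  (0 <= mu A + \int[leb]_(x in A) (h x)%:E)%E.
Hypothesis h_mean0 : (\int[leb]_x (h x)%:E = 0)%E.

(** The sum is nonnegative on measurable sets only, so the set function is
replaced by [0] elsewhere. *)
Lemma exists_perturbed_law : exists Q : probability R R,
  forall A : set R, measurable A -> Q A = (mu A + \int[leb]_(x in A) (h x)%:E)%E.
Proof.
pose q (A : set R) : \bar R := if A \in (measurable : set (set R)) then
  (mu A + \int[leb]_(x in A) (h x)%:E)%E else 0%E.
have qE A : measurable A -> q A = (mu A + \int[leb]_(x in A) (h x)%:E)%E.
  by move=> mA; rewrite /q mem_set.
have q0 : q set0 = 0%E by rewrite qE// measure0 integral_set0 adde0.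
have q_ge0 A : (0 <= q A)%E.
  by rewrite /q; case: ifPn => //; rewrite inE; exact: h_ge.
have h_fin A : measurable A -> (\int[leb]_(x in A) (h x)%:E)%E \is a fin_num.
  by move=> mA; apply: integrable_fin_num => //; apply: integrableS h_int.
have q_sadd : semi_sigma_additive q.
  move=> F mF tF mUF; rewrite qE//.
  have -> : (fun n => \sum_(0 <= i < n) q (F i))%E =
      ((fun n => \sum_(0 <= i < n) mu (F i)) \+
       (fun n => \sum_(0 <= i < n) \int[leb]_(x in F i) (h x)%:E))%E.
    by apply/funext => n; rewrite /= -big_split/=; apply: eq_bigr => i _; rewrite qE.
  apply: cvgeD.
  - by apply: fin_num_adde_defl; exact: h_fin.
  - exact: measure_semi_sigma_additive.
  - exact: (@charge_semi_sigma_additive _ _ _ (induced_charge h_int) F mF tF mUF).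
pose qM := isMeasure.Build _ _ _ q q0 q_ge0 q_sadd.
pose m : {measure set R -> \bar R} := HB.pack q qM.
have m1 : m setT = 1%E by rewrite [LHS]qE// h_mean0 adde0 probability_setT.
pose mP := Measure_isProbability.Build _ _ _ m m1.
pose Q : probability R R := HB.pack (Measure.sort m) mP.
by exists Q => A mA; exact: qE.
Qed.

Variable Q : probability R R.
Hypothesis QE : forall A : set R, measurable A ->
  Q A = (mu A + \int[leb]_(x in A) (h x)%:E)%E.

Let mh : measurable_fun setT h. Proof. exact: integrable_measurable h_int. Qed.

Let norm_pos_part y : `|Num.max y 0| <= `|y| :> R.
Proof. by case: (leP 0 y) => y0; rewrite ?normr0. Qed.

Let norm_neg_part y : `|Num.max (- y) 0| <= `|y| :> R.
Proof. by rewrite -(normrN y) norm_pos_part. Qed.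

(* [Q] plus the density [h^-] is [mu] plus the density [h^+] *)
Let ge0_integral_perturbed (g : R -> R) : measurable_fun setT g ->
  (forall x, 0 <= g x) ->
  (\int[Q]_x (g x)%:E + \int[leb]_x ((g x)%:E * (Num.max (- h x) 0)%:E) =
   \int[mu]_x (g x)%:E + \int[leb]_x ((g x)%:E * (Num.max (h x) 0)%:E))%E.
Proof.
move=> mg g0.
have mp : measurable_fun setT (fun x => Num.max (h x) 0) by exact: measurable_maxr.
have mn : measurable_fun setT (fun x => Num.max (- h x) 0).
  by apply: measurable_maxr => //; exact: measurableT_comp.
have p0 x : 0 <= Num.max (h x) 0 by rewrite le_max lexx orbT.
have n0 x : 0 <= Num.max (- h x) 0 by rewrite le_max lexx orbT.
have [nup nupE] := exists_density_measure mp p0.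
have [nun nunE] := exists_density_measure mn n0.
have mgE : measurable_fun setT (fun x => (g x)%:E : \bar R) by exact/measurable_EFinP.
have gE0 x : (0 <= (g x)%:E)%E by rewrite lee_fin.
rewrite -(ge0_integral_lebesgue_density mn n0 nunE)//.
rewrite -(ge0_integral_lebesgue_density mp p0 nupE)//.
rewrite -!ge0_integral_measure_add//.
apply: eq_measure_integral => A mA _.
apply: (etrans (measure_addE _ _ _)); apply: (etrans _ (esym (measure_addE _ _ _))).
rewrite [X in (X + _)%E = _](QE mA) [X in (_ + X)%E = _](nunE A mA).
rewrite [X in _ = (_ + X)%E](nupE A mA) -addeA; congr (_ + _)%E.
have Ih : leb.-integrable A (EFin \o h) by apply: integrableS h_int.
have In : leb.-integrable A (EFin \o (fun x => Num.max (- h x) 0)).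
  apply: integrable_le (integrable_norm Ih) => //.
    exact: measurable_funS mn.
rewrite -integralD_EFin//; apply: eq_integral => x _ /=; congr EFin.
by case: (leP 0 (h x)) => hx; case: (leP 0 (- h x)) => hx'; lra.
Qed.

Let ge0_Rintegral_perturbed (g : R -> R) : (forall x, 0 <= g x) ->
  mu.-integrable setT (EFin \o g) ->
  leb.-integrable setT (EFin \o (fun x => g x * h x)) ->
  Q.-integrable setT (EFin \o g) /\
  \int[Q]_x g x = \int[mu]_x g x + \int[leb]_x (g x * h x).
Proof.
move=> g0 Ig Igh; have mg := integrable_measurable Ig.
have Ip : leb.-integrable setT (EFin \o (fun x => g x * Num.max (h x) 0)).
  apply: integrable_le (integrable_norm Igh) => //.
    by apply: measurable_funM => //; exact: measurable_maxr.
  by move=> x _ /=; rewrite !normrM ler_wpM2l// norm_pos_part.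
have In : leb.-integrable setT (EFin \o (fun x => g x * Num.max (- h x) 0)).
  apply: integrable_le (integrable_norm Igh) => //.
    apply: measurable_funM => //; apply: measurable_maxr => //.
    exact: measurableT_comp.
  by move=> x _ /=; rewrite !normrM ler_wpM2l// norm_neg_part.
have := ge0_integral_perturbed mg g0.
rewrite !(EFin_Rintegral measurableT Ig).
rewrite (EFin_Rintegral measurableT Ip) (EFin_Rintegral measurableT In).
have -> : \int[leb]_x (g x * h x) =
  \int[leb]_x (g x * Num.max (h x) 0) - \int[leb]_x (g x * Num.max (- h x) 0).
  rewrite -RintegralB//; apply: eq_Rintegral => x _; rewrite -mulrBr; congr (_ * _).
  by case: (leP 0 (h x)) => hx; case: (leP 0 (- h x)) => hx'; lra.
rewrite -EFinD => E; have Q_fin : (\int[Q]_x (g x)%:E < +oo)%E.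
  by move: E; case: (integral Q _ _) => // r _; rewrite ltry.
have IQ : Q.-integrable setT (EFin \o g) by exact: integrable_lt_pinfty.
split=> //; move: E; rewrite (EFin_Rintegral measurableT IQ) -EFinD => -[].
by lra.
Qed.

(** [g] is the difference of the nonnegative functions [`|g|] and [`|g| - g]. *)
Lemma Rintegral_perturbed (g : R -> R) :
  mu.-integrable setT (EFin \o g) ->
  leb.-integrable setT (EFin \o (fun x => g x * h x)) ->
  Q.-integrable setT (EFin \o g) /\
  \int[Q]_x g x = \int[mu]_x g x + \int[leb]_x (g x * h x).
Proof.
move=> Ig Igh; have mg := integrable_measurable Ig.
have Ia : mu.-integrable setT (EFin \o (fun x => `|g x|)) by exact: integrable_norm Ig.
have Iah : leb.-integrable setT (EFin \o (fun x => `|g x| * h x)).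
  apply: integrable_le (integrable_norm Igh) => //.
    by apply: measurable_funM => //; exact: measurableT_comp.
  by move=> x _; rewrite /= !normrM normr_id.
have Ib : mu.-integrable setT (EFin \o (fun x => `|g x| - g x)).
  have -> : (fun x => `|g x| - g x) = (fun x => `|g x| + -1 * g x).
    by apply/funext => x; rewrite mulN1r.
  by apply: integrable_EFinD => //; exact: integrable_EFinZ.
have Ibh : leb.-integrable setT (EFin \o (fun x => (`|g x| - g x) * h x)).
  have -> : (fun x => (`|g x| - g x) * h x) = (fun x => `|g x| * h x + -1 * (g x * h x)).
    by apply/funext => x; ring.
  by apply: integrable_EFinD => //; exact: integrable_EFinZ.
have [IaQ Ea] := ge0_Rintegral_perturbed (fun x => normr_ge0 (g x)) Ia Iah.
have b0 x : 0 <= `|g x| - g x by rewrite subr_ge0 ler_norm.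
have [IbQ Eb] := ge0_Rintegral_perturbed b0 Ib Ibh.
have IgQ : Q.-integrable setT (EFin \o g).
  have -> : g = (fun x => `|g x| + -1 * (`|g x| - g x)) by apply/funext => x; ring.
  by apply: integrable_EFinD => //; exact: integrable_EFinZ.
split=> //; move: Eb.
under [in X in _ = _ + X -> _]eq_Rintegral do rewrite mulrBl.
by rewrite !RintegralB//; lra.
Qed.

End perturbation.

(** * Indeterminacy from a heavy tail *)

Section vanishing_moments_perturbation.
Context {R : realType}.
Local Notation leb := (@lebesgue_measure R).
Variables (C c dl : R) (m : nat).
Hypotheses (C_gt0 : 0 < C) (c_gt0 : 0 < c) (dl_gt0 : 0 < dl) (dl_lt : dl < 2^-1).

(* makes the exponential rate of the Stieltjes function equal to [c] *)
Let l : R := c / cos (pi * dl).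

Let angle : 0 < pi * dl < pi / 2.
Proof. by rewrite mulr_gt0 ?pi_gt0//= ltr_pM2l ?pi_gt0. Qed.

Let cos_angle : 0 < cos (pi * dl).
Proof.
have /andP[h1 h2] := angle; apply: cos_gt0_pihalf.
by rewrite h2 andbT; apply: lt_trans h1; rewrite oppr_lt0 divr_gt0 ?pi_gt0.
Qed.

Let sin_angle : 0 < sin (pi * dl).
Proof.
have /andP[h1 h2] := angle; apply: sin_gt0_pi; rewrite h1/=.
by apply: lt_trans h2 _; rewrite ltr_pdivrMr// ltr_pMr ?pi_gt0 ?ltr1n.
Qed.

Let l_gt0 : 0 < l. Proof. by rewrite divr_gt0. Qed.

Let lcos : l * cos (pi * dl) = c. Proof. by rewrite divfK// gt_eqF. Qed.

Definition weibull_perturbation : R -> R :=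
  (fun x => C * (x ^+ m * stieltjes_fun l dl x)) \_ `]0, +oo[.
Local Notation h := weibull_perturbation.

Lemma weibull_perturbationE x : 0 < x -> h x = C * (x ^+ m * stieltjes_fun l dl x).
Proof. by move=> x0; rewrite /h patchE mem_set//= in_itv/= x0. Qed.

Lemma weibull_perturbation_le0 x : x <= 0 -> h x = 0.
Proof.
move=> x0; rewrite /h patchE memNset//= in_itv/= andbT.
by apply/negP; rewrite -leNgt.
Qed.

Lemma norm_weibull_perturbation x : `|h x| <= weibull_density C c dl m x.
Proof.
have [x0|x0] := leP x 0.
  by rewrite weibull_perturbation_le0// weibull_density_le0// normr0.
rewrite weibull_perturbationE// weibull_densityE// /stieltjes_fun lcos.
rewrite !normrM (gtr0_norm C_gt0) (ler_pM2l C_gt0) ger0_norm ?exprn_ge0 ?(ltW x0)//.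
rewrite ler_wpM2l ?exprn_ge0 ?(ltW x0)// ger0_norm ?expR_ge0//.
by rewrite ler_piMr ?expR_ge0// ler_norml sin_le1 sin_geN1.
Qed.

Lemma measurable_weibull_perturbation (D : set R) : measurable_fun D h.
Proof.
apply: (measurable_funS measurableT) => //.
apply/(measurable_restrictT _ _).1 => //.
apply: (measurable_funS measurableT) => //.
have mp k : measurable_fun setT (fun x : R => k * x `^ dl).
  by apply: measurable_funM => //; exact: measurable_powR.
apply: measurable_funM => //; apply: measurable_funM; first exact: measurable_funX.
apply: measurable_funM.
  by apply: measurableT_comp => //; apply: measurableT_comp.
apply: (measurableT_comp (f := sin)) => //.
by apply: continuous_measurable_fun; exact: continuous_sin.
Qed.

Lemma integrable_exprn_weibull k :
  leb.-integrable setT (EFin \o (fun x => x ^+ k * weibull_density C c dl m x)).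
Proof.
have := integrable_EFinZ C _ (integrable_powR_expR (ler0n R (k + m)) c_gt0 dl_gt0).
have mI : measurable (`]0, +oo[%classic : set (measurableTypeR R)) by exact: measurable_itv.
move=> /(_ mI) /(integrable_mkcond _ mI).1; rewrite restrict_EFin; congr (integrable _ _ (EFin \o _)); apply/funext => x.
rewrite patchE; case: ifPn => [|]; rewrite ?inE ?notin_setE/= in_itv/= andbT.
  move=> x0; rewrite weibull_densityE// powR_mulrn ?(ltW x0)// exprD; ring.
by move=> /negP; rewrite -leNgt => x0; rewrite weibull_density_le0// mulr0.
Qed.

Lemma integrable_exprn_perturbation k :
  leb.-integrable setT (EFin \o (fun x => x ^+ k * h x)).
Proof.
apply: integrable_le (integrable_norm (integrable_exprn_weibull k)) => //.
  apply: measurable_funM; first exact: measurable_funX.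
  exact: measurable_weibull_perturbation.
move=> x _ /=; rewrite !normrM ler_wpM2l// (le_trans (norm_weibull_perturbation x))//.
exact: ler_norm.
Qed.

Lemma perturbation_moment k : \int[leb]_x (x ^+ k * h x) = 0.
Proof.
pose f := (fun x => x ^+ (k + m) * stieltjes_fun l dl x) \_ `]0, +oo[.
have E x : x ^+ k * h x = C * f x.
  rewrite /f /h !patchE; case: ifPn => _; last by rewrite !mulr0.
  by rewrite exprD; ring.
have If : leb.-integrable setT (EFin \o f).
  have -> : f = (fun x => C^-1 * (x ^+ k * h x)).
    by apply/funext => x; rewrite E mulKf// gt_eqF.
  by apply: integrable_EFinZ => //; exact: integrable_exprn_perturbation.
under eq_Rintegral do rewrite E.
by rewrite RintegralZl// -Rintegral_mkcond stieltjes_fun_moment// mulr0.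
Qed.

(** Near [0] the argument of the sine is less than [1], so the perturbation is
positive there. *)
Lemma perturbation_neq0 :
  exists2 A : set R, measurable A & (\int[leb]_(x in A) (h x)%:E)%E <> 0%E.
Proof.
pose s := l * sin (pi * dl); have s0 : 0 < s by rewrite mulr_gt0.
pose r := s^-1 `^ dl^-1; have r0 : 0 < r by rewrite powR_gt0 ?invr_gt0.
have h_gt0 x : `]0, r[%classic x -> 0 < h x.
  rewrite /= in_itv/= => /andP[x0 xr]; rewrite weibull_perturbationE//.
  rewrite !mulr_gt0 ?expR_gt0 ?exprn_gt0//.
  apply: sin_gt0_pi; rewrite -/s mulr_gt0 ?powR_gt0//=.
  have : x `^ dl < r `^ dl by rewrite gt0_ltr_powR ?nnegrE ?(ltW x0) ?(ltW r0).
  rewrite /r -powRrM mulVf ?gt_eqF// powRr1 ?invr_ge0 ?(ltW s0)// => xs.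
  apply: (@lt_trans _ _ 1); last by apply: lt_le_trans (pi_ge2 R); rewrite ltr1n.
  by rewrite -ltr_pdivlMl// mulr1.
exists `]0, r[%classic; first exact: measurable_itv.
move=> I0.
have mI : measurable (`]0, r[%classic : set (measurableTypeR R)) by exact: measurable_itv.
have mhE : measurable_fun (`]0, r[%classic : set (measurableTypeR R)) (EFin \o h).
  by apply/measurable_EFinP; exact: measurable_weibull_perturbation.
have : (\int[leb]_(x in `]0%R, r[) `|(EFin \o h) x| = 0)%E.
  rewrite -I0; apply: eq_integral => x; rewrite inE => /h_gt0 hx.
  by rewrite /= gtr0_norm.
move=> /(ae_eq_integral_abs leb mI mhE) [N [mN N0 IN]].
have : (leb (`]0%R, r[%classic : set R) <= leb N)%E.
  apply: le_measure; rewrite ?inE// => x xI; apply: IN => /= /(_ xI) [].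
  by apply/eqP; rewrite gt_eqF// h_gt0.
by rewrite N0 lebesgue_measure_itv/= lte_fin r0 oppr0 adde0 lee_fin leNgt r0.
Qed.

End vanishing_moments_perturbation.

Section indeterminacy.
Context d (T : measurableType d) (R : realType) (P : probability T R).
Local Notation leb := (@lebesgue_measure R).

Lemma heavy_tailed_not_determinate (X : {RV P >-> R}) m (dl : R) :
  0 < dl -> dl < 2^-1 -> heavy_tailed m dl (distribution P X) ->
  ~ moment_determinate P X.
Proof.
move=> dl0 dl2 [C [c [C0 c0 hX]]] [mom det].
pose h := weibull_perturbation C c dl m.
have Ih : leb.-integrable setT (EFin \o h).
  have := integrable_exprn_perturbation m C0 c0 dl0 dl2 0.
  by congr (integrable _ _ (EFin \o _)); apply/funext => x; rewrite mul1r.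
have Iw : leb.-integrable setT (EFin \o weibull_density C c dl m).
  have := integrable_exprn_weibull C m c0 dl0 0.
  by congr (integrable _ _ (EFin \o _)); apply/funext => x; rewrite mul1r.
have hw x : `|h x| <= weibull_density C c dl m x by exact: norm_weibull_perturbation.
have h_ge (A : set R) : measurable A ->
    (0 <= distribution P X A + \int[leb]_(x in A) (h x)%:E)%E.
  move=> mA; apply: (@le_trans _ _ (\int[leb]_(x in A) (weibull_density C c dl m x)%:E +
    \int[leb]_(x in A) (h x)%:E)%E); last by apply: leeD => //; exact: hX.
  have IhA : leb.-integrable A (EFin \o h) by apply: integrableS Ih.
  have IwA : leb.-integrable A (EFin \o weibull_density C c dl m) by apply: integrableS Iw.
  rewrite -integralD_EFin//; apply: integral_ge0 => x _ /=; rewrite lee_fin.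
  by have := hw x; rewrite ler_norml => /andP[]; lra.
have h0 : (\int[leb]_x (h x)%:E = 0)%E.
  rewrite EFin_Rintegral//; congr EFin.
  rewrite -[RHS](perturbation_moment m C0 c0 dl0 dl2 0).
  by apply: eq_Rintegral => x _; rewrite mul1r.
have [Q QE] := exists_perturbed_law Ih h_ge h0.
have [A mA] := perturbation_neq0 m C0 c0 dl0 dl2.
have -> : (\int[leb]_(x in A) (h x)%:E = Q A - distribution P X A)%E.
  by rewrite QE// addeAC subee ?add0e// fin_num_measure.
rewrite det//; first by rewrite subee// fin_num_measure.
move=> k k0.
have mk : measurable_fun setT (fun x : R => x ^+ k) by exact: measurable_funX.
have Ik : (distribution P X).-integrable setT (EFin \o (fun x => x ^+ k)).
  by apply: integrable_law => //; exact: mom.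
have [IQ EQ] := Rintegral_perturbed Ih QE Ik (integrable_exprn_perturbation m C0 c0 dl0 dl2 k).
split=> //; rewrite unlock (EFin_Rintegral measurableT IQ) EQ.
rewrite (perturbation_moment m C0 c0 dl0 dl2) addr0 -(EFin_Rintegral measurableT Ik).
rewrite integral_distribution//; first exact/measurable_EFinP.
exact: mom.
Qed.

End indeterminacy.

(** * The criterion *)

Theorem corollary1 (R : realType) (d : measure_display) (T : measurableType d)
    (P : probability T R) (n : nat) (n_gt0 : (0 < n)%N)
    (alpha beta gamma : 'I_n -> R)
    (alpha_gt0 : forall i, 0 < alpha i)
    (beta_gt0 : forall i, 0 < beta i)
    (gamma_gt0 : forall i, 0 < gamma i)
    (xi : 'I_n -> {RV P >-> R})
    (xi_indep : mutually_independent P xi)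
    (xi_GG : forall i,
        gengamma_distributed P (xi i) (alpha i) (beta i) (gamma i))
    (Z : {RV P >-> R})
    (Z_prod : forall w, Z w = \prod_(i < n) xi i w) :
  moment_determinate P Z <->
  \sum_(i < n) (beta i)^-1 <= 2.
Proof.
have -> : Z = partial_prod xi n.
  by apply/mfuneqP => w; rewrite Z_prod partial_prod_full.
have sumE : \sum_(i < n) (beta i)^-1 = \sum_(i < n | (i < n)%N) (beta i)^-1.
  by apply: eq_bigl => i; rewrite ltn_ord.
split=> [|sum_le].
  apply: contraPP => /negP; rewrite -ltNge => sum_gt.
  (* a common power of [x] for all the factors *)
  pose m := (\max_(i < n) Num.bound (gamma i))%N.
  apply: (@heavy_tailed_not_determinate _ _ _ _ _ m (\sum_(i < n) (beta i)^-1)^-1).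
  - by rewrite invr_gt0 (lt_trans _ sum_gt).
  - by rewrite ltf_pV2 ?posrE// (lt_trans _ sum_gt).
  rewrite sumE; apply: partial_prod_heavy_tailed => //; first by rewrite n_gt0 leqnn.
  move=> i; apply: gengamma_heavy_tailed (alpha_gt0 i) (beta_gt0 i) (xi_GG i) _ _.
  apply: (@le_trans _ _ (gamma i)); first by rewrite gerBl.
  apply: (le_trans (ltW (archi_boundP (ltW (gamma_gt0 i))))).
  by rewrite ler_nat (leq_bigmax i).
have xi_ge0 i : {ae P, forall w, 0 <= xi i w}.
  exact/law_ae_ge0/(gengamma_ae_ge0 (xi_GG i)).
have growth i := gengamma_moment_growth (alpha_gt0 i) (beta_gt0 i) (gamma_gt0 i) (xi_GG i).
have [L L0 hL] := partial_prod_moment_growth xi_indep (leqnn n) growth.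
apply: (@moment_determinate_of_growth _ _ _ _ _ (L * expR 2)).
- have : {ae P, forall w, forall i, 0 <= xi i w} by apply: filter_forall.
  by apply: filterS => w xi0; rewrite partial_prod_full prodr_ge0.
- by rewrite mulr_ge0// expR_ge0.
- move=> k; apply: (le_trans (hL k)); rewrite lee_fin exprMn -mulrA.
  by rewrite ler_wpM2l ?exprn_ge0// powR_nat_le_fact// -sumE.
Qed.
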